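(* Let $T$ be an equilateral compact metric tree rooted at $v_0$, with edges of length $\ell>0$ and real-valued potentials $q_j\in L^2(0,\ell)$, and let $T_\infty$ be obtained from $T$ by attaching a half-infinite lead $e_0=[0,\infty)$ at $v_0$ with potential $q_0=0$ on $e_0$. Then the number of the isolated (negative) eigenvalues of $L_\infty$ is equal to the number of the (isolated) negative eigenvalues of $L_N$, in both cases counting (geometric) multiplicities.
   Context: Tree. $T$ is a finite metric tree with $p\ge2$ vertices and $g=p-1$ edges $e_1,\dots,e_g$, all of length $\ell>0$, with a chosen vertex $v_0$ as root. $d(v)$ is the degree of $v$ in $T$ (the lead is not counted). Edges are directed away from the root and each is identified with $[0,\ell]$, $x=0$ being its initial vertex; each vertex $v\ne v_0$ has exactly one incoming edge. The edges outgoing from $v_0$ are $e_1,\dots,e_{d(v_0)}$. The potential on $e_j$ is $q_j$. Vertex conditions. Standard conditions at $v\neq v_0$ with incoming edge $e_j$: $y_j'(\ell)=0$ if $v$ is pendant; if $v$ is interior, $y_j(\ell)=y_k(0)$ for every edge $e_k$ outgoing from $v$ and $y_j'(\ell)=\sum_k y_k'(0)$, the sum being over edges outgoing from $v$. Standard conditions at $v_0$ in $T$: $y_1(0)=y_k(0)$ for $k=2,\dots,d(v_0)$ and $\sum_{k=1}^{d(v_0)}y_k'(0)=0$. $L_N$ is the operator $(y_j)\mapsto(-y_j''+q_jy_j)$ in $\bigoplus_{j=1}^gL^2(0,\ell)$ with domain all $(y_j)\in\bigoplus_{j=1}^g H^2(0,\ell)$ satisfying standard conditions at all vertices of $T$.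 Operator $L_\infty$. In $L^2(T_\infty)=L^2(0,\infty)\oplus\bigoplus_{j=1}^gL^2(0,\ell)$, $L_\infty(y_j)_{j=0}^g=(-y_j''+q_jy_j)_{j=0}^g$ with $q_0=0$, and domain all $(y_j)_{j=0}^g\in H^2(0,\infty)\oplus\bigoplus_{j=1}^gH^2(0,\ell)$ satisfying the standard conditions at all $v\ne v_0$ and, at $v_0$, $y_0(0)=y_k(0)$, $k=1,\dots,d(v_0)$, and $\sum_{k=0}^{d(v_0)}y_k'(0)=0$. The operator $L_\infty$ is self-adjoint, bounded from below, with essential spectrum $[0,\infty)$, so its isolated eigenvalues are the negative ones. *)

(* Defs.v *)
From HB Require Import structures.
From mathcomp Require Import all_boot all_order all_algebra.
From mathcomp Require Import all_classical all_reals all_analysis.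
From mathcomp Require Import complex.

Set Implicit Arguments.
Unset Strict Implicit.
Unset Printing Implicit Defensive.

Import Order.TTheory GRing.Theory Num.Theory.

Import numFieldNormedType.Exports.

Local Open Scope classical_set_scope.
Local Open Scope ring_scope.
Local Open Scope complex_scope.

(* Edges carry an orientation [tinit e] -> [tterm e]. The underlying undirected
   multigraph is connected with one edge fewer than vertices, i.e. a tree, and
   the orientation points away from the root. *)
Record rooted_tree := RootedTree {
  vertex : finType;
  edge : finType;
  tinit : edge -> vertex;
  tterm : edge -> vertex;
  root : vertex;
  tree_gt1 : (1 < #|vertex|)%N;
  tree_connected : forall u v : vertex,
    connect (fun a b => [exists e, ((tinit e == a) && (tterm e == b))
                                || ((tinit e == b) && (tterm e == a))]) u v;
  tree_card : #|edge| = #|vertex|.-1;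
  tree_directed : forall v : vertex,
    connect (fun a b => [exists e, (tinit e == a) && (tterm e == b)]) root v
}.

Lemma incoming_edge (T : rooted_tree) :
  [/\ injective (@tterm T), forall e : edge T, tterm e != root T &
      forall v : vertex T, v != root T -> exists e, tterm e = v].
Proof.
have ex v : v != root T -> exists e, tterm e = v.
  move=> vr; have /connectP[p] := tree_directed v.
  case/lastP: p => [_ /= vE|p w]; first by rewrite vE eqxx in vr.
  rewrite rcons_path last_rcons => /andP[_ /existsP[e /andP[_ /eqP <-]]] ->.
  by exists e.
pose A := [set tterm e | e in [set: edge T]]%SET.
have sub : ([set~ root T] \subset A)%SET.
  apply/fintype.subsetP => v; rewrite !inE => /ex[e <-].
  by apply/imsetP; exists e; rewrite ?inE.
have leA : (#|A| <= #|edge T|)%N by rewrite -cardsT leq_imset_card.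
have geA := subset_leq_card sub.
have cE : #|A| = #|edge T|.
  apply/eqP; rewrite eqn_leq leA /= (tree_card T).
  by move: geA; rewrite cardsC1.
split=> [||//].
- move=> a b ab; have : (#|A| == #|[set: edge T]|)%SET by rewrite cardsT cE.
  by move=> /imset_injP/(_ a b); rewrite !inE => /(_ isT isT ab).
- move=> e.
  have : ([set~ root T] == A)%SET.
    by rewrite eqEcard sub cE (tree_card T) cardsC1 leqnn.
  move=> /eqP/setP/(_ (tterm e)); rewrite !inE.
  by move=> ->; apply/imsetP; exists e; rewrite ?inE.
Qed.

Section sobolev.
Context {R : realType}.

Definition L2 (D : set R) (f : R -> R) : Prop :=
  measurable_fun D f /\
  lebesgue_measure.-integrable D (fun x => (f x ^+ 2)%:E).

(* [D] is a closed interval with left end point 0. The Sobolev space H^2 of its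
   interior consists of the u in L^2 with u, u' absolutely continuous and
   u', u'' in L^2; [H2_real D u u1 u2] says that u is the C^1 representative of
   such a function, u1 its derivative, and u2 a representative of its second
   (weak) derivative. *)
Definition H2_real (D : set R) (u u1 u2 : R -> R) : Prop :=
  [/\ L2 D u, L2 D u1, L2 D u2 &
    forall x, D x ->
      u x = u 0 + \int[lebesgue_measure]_(t in `[0, x]) u1 t /\
      u1 x = u1 0 + \int[lebesgue_measure]_(t in `[0, x]) u2 t].

Definition H2 (D : set R) (u u1 u2 : R -> R[i]) : Prop :=
  H2_real D (@complex.Re R \o u) (@complex.Re R \o u1) (@complex.Re R \o u2) /\
  H2_real D (@complex.Im R \o u) (@complex.Im R \o u1) (@complex.Im R \o u2).

End sobolev.

Section operators.
Context {R : realType} {I : finType}.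
Implicit Types (D : I -> set R) (y z : I -> R -> R[i]).

(* An unbounded operator in the direct sum of the L^2(D j) is given by its
   graph. An element of its domain is represented by its C^1 representative;
   values outside D j are irrelevant. *)
Definition operator := (I -> R -> R[i]) -> (I -> R -> R[i]) -> Prop.

(* y |-> (- y_j'' + q_j y_j)_j on the (y_j) in H^2 with bc (y_j) (y_j') *)
Definition schrodinger D (q : I -> R -> R)
    (bc : (I -> R -> R[i]) -> (I -> R -> R[i]) -> Prop) : operator :=
  fun y z => exists y1 y2 : I -> R -> R[i],
    [/\ forall j, H2 (D j) (y j) (y1 j) (y2 j),
        bc y y1 &
        forall j, {ae (@lebesgue_measure R), forall x, D j x ->
          z j x = - y2 j x + (q j x)%:C * y j x}].

Definition eigenspace (A : operator) (lam : R) : set (I -> R -> R[i]) :=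
  [set y | A y (fun j x => lam%:C * y j x)].

(* linear independence over the complex numbers, in the sum of the L^2(D j) *)
Definition lin_indep D n (b : 'I_n -> I -> R -> R[i]) : Prop :=
  forall c : 'I_n -> R[i],
    (forall j, {ae (@lebesgue_measure R), forall x, D j x ->
       \sum_(k < n) c k * b k j x = 0}) ->
    forall k, c k = 0.

(* geometric multiplicity; it is 0 when lam is not an eigenvalue *)
Definition multiplicity D (A : operator) (lam : R) : \bar R :=
  ereal_sup [set n%:R%:E | n in [set n : nat |
    exists b : 'I_n -> I -> R -> R[i],
      (forall k, eigenspace A lam (b k)) /\ lin_indep D b]].

Definition num_neg_eigenvalues D (A : operator) : \bar R :=
  \esum_(lam in [set lam : R | lam < 0]) multiplicity D A lam.

End operators.

Section tree_operators.
Context {R : realType} (T : rooted_tree) (l : R).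

(* Conditions at all v <> v_0. Such a v is the end of a unique edge j; if v is
   pendant, no edge k leaves v and the second sum is empty, so the condition
   reads y_j'(l) = 0. *)
Definition std_nonroot (y y1 : edge T -> R -> R[i]) : Prop :=
  (forall j k, tinit k = tterm j -> y j l = y k 0) /\
  (forall j, y1 j l = \sum_(k | tinit k == tterm j) y1 k 0).

Definition bc_N (y y1 : edge T -> R -> R[i]) : Prop :=
  [/\ std_nonroot y y1,
      forall j k, tinit j = root T -> tinit k = root T -> y j 0 = y k 0 &
      \sum_(k | tinit k == root T) y1 k 0 = 0].

Definition dom_N : edge T -> set R := fun _ => `[0, l]%classic.

Definition L_N (q : edge T -> R -> R) : operator := schrodinger dom_N q bc_N.

(* On T_oo the index [None] stands for the lead e_0. *)
Definition bc_oo (y y1 : option (edge T) -> R -> R[i]) : Prop :=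
  [/\ std_nonroot (fun j => y (Some j)) (fun j => y1 (Some j)),
      forall k, tinit k = root T -> y None 0 = y (Some k) 0 &
      y1 None 0 + \sum_(k | tinit k == root T) y1 (Some k) 0 = 0].

Definition dom_oo : option (edge T) -> set R :=
  fun j => if j is Some _ then `[0, l]%classic else `[0, +oo[%classic.

Definition q_oo (q : edge T -> R -> R) : option (edge T) -> R -> R :=
  fun j => if j is Some j then q j else fun=> 0.

Definition L_oo (q : edge T -> R -> R) : operator :=
  schrodinger dom_oo (q_oo q) bc_oo.

End tree_operators.

(* Main.v *)
Require Import Defs.
From mathcomp Require Import all_boot all_order all_algebra.
From mathcomp Require Import all_classical all_reals all_analysis.
From mathcomp Require Import measurable_realfun complex zify ring lra.
Import Defs.

(** Every edge is cut into [N] pieces of equal length, so short that for all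
    [lam] in a window [[- lam0, 0]] the equation [- u'' + q u = lam u] has
    exactly one solution with prescribed boundary values on each piece
    ([sol_exists], [sol_bound]), while there is no eigenvalue below [- lam0]
    ([tree_sol_low]). A function that solves the equation on all pieces is
    determined by its values at the finitely many nodes (vertices and cuts).
    It is an eigenfunction exactly when its outward derivatives add up to zero
    at every node, and this is a linear condition [c *m M lam = 0] on the row
    [c] of the node values. The matrix [M lam] is the sum over the pieces of
    their 2x2 Dirichlet-to-Neumann matrices; it is real and symmetric
    ([dtn_exists], [M_sym]). So the multiplicity of [lam] for L_N is the
    dimension of the kernel of [M lam] ([multiplicity_N]).

    On the lead, a square integrable solution with [lam < 0] is a multiple of
    [exp (- sqrt (- lam) x)] ([lead_exp]). Attaching the lead therefore changes
    the condition at the root into a Robin condition: for L_oo the multiplicity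
    is the dimension of the kernel of [M lam + sqrt (- lam) E], where [E] is
    the diagonal matrix unit of the root ([multiplicity_oo]).

    Both families of matrices are continuous on [[- lam0, 0]], strictly
    decreasing as quadratic forms, and positive definite at [- lam0]. When
    [lam] increases, the number of negative squares of such a family starts
    from 0, is constant on a left neighbourhood of every point, and grows by
    the dimension of the kernel as soon as the point is passed. Hence the
    dimensions of the kernels over [- lam0 < lam < 0] add up to the number of
    negative squares at [lam = 0] ([sum_nullity]). There [sqrt (- lam)]
    vanishes, the two families meet, and so the two counts are equal.

    Strict monotonicity comes from the identity of Green together with the
    nonnegativity of the energy on functions that vanish at the ends of a short
    piece ([flux_decr]). As the potentials are only square integrable, the
    equation is used in integrated form, and integration by parts is needed for
    absolutely continuous functions ([int_by_parts]). *)

Set Implicit Arguments.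
Unset Strict Implicit.
Unset Printing Implicit Defensive.

Import Order.TTheory GRing.Theory Num.Theory.
Import numFieldNormedType.Exports.

Local Open Scope classical_set_scope.
Local Open Scope ring_scope.

(** * Integrals over compact intervals *)

Section interval_integrals.
Context {R : realType}.
Implicit Types (a b c k x y C : R) (f g u : R -> R).
Local Notation mu := (@lebesgue_measure R).

Definition intg a b f := mu.-integrable `[a, b] (EFin \o f).
Definition itg a b f := \int[mu]_(t in `[a, b]) f t.
(** Bounded measurable functions on [[a, b]] are the multipliers of the integrable
    ones; this class is stable under all operations met below. *)
Definition bmf a b f :=
  measurable_fun `[a, b] f /\ exists C, forall x, a <= x <= b -> `|f x| <= C.

Lemma intg_sub a b a' b' f : a <= a' -> b' <= b -> intg a b f -> intg a' b' f.
Proof.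
move=> aa bb; apply: integrableS => //.
by apply: subset_itv; rewrite ?bnd_simp.
Qed.

Lemma eq_intg a b f g : (forall x, a <= x <= b -> f x = g x) ->
  intg a b f -> intg a b g.
Proof.
move=> fg; apply: eq_integrable => // x; rewrite inE/= in_itv/= => xab.
by rewrite fg.
Qed.

Lemma eq_itg a b f g : (forall x, a <= x <= b -> f x = g x) ->
  itg a b f = itg a b g.
Proof.
by move=> fg; apply: eq_Rintegral => x; rewrite inE/= in_itv/=; exact: fg.
Qed.

Lemma itg_chasles a b c f : a <= b -> b <= c -> intg a c f ->
  itg a c f = itg a b f + itg b c f.
Proof.
move=> ab bc fi; apply/eqP; rewrite addrC -subr_eq; apply/eqP.
rewrite /itg (Rintegral_itvB fi) ?bnd_simp//.
rewrite Rintegral_itv_obnd_cbnd//.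
by apply: integrableS fi => //; apply: subset_itv; rewrite ?bnd_simp.
Qed.

Lemma itgxx a f : itg a a f = 0.
Proof. by rewrite /itg set_itv1 Rintegral_set1. Qed.

Lemma intgD a b f g : intg a b f -> intg a b g -> intg a b (fun x => f x + g x).
Proof. by move=> fi gi; have := integrableD _ fi gi; apply. Qed.

Lemma intgZ a b k f : intg a b f -> intg a b (fun x => k * f x).
Proof. by move=> fi; have := integrableZl _ k fi; apply. Qed.

Lemma intgN a b f : intg a b f -> intg a b (fun x => - f x).
Proof. by move=> /(intgZ (-1)); apply: eq_intg => x _; rewrite mulN1r. Qed.

Lemma intgB a b f g : intg a b f -> intg a b g -> intg a b (fun x => f x - g x).
Proof. by move=> fi /intgN; exact: intgD. Qed.

Lemma intg_norm a b f : intg a b f -> intg a b (fun x => `|f x|).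
Proof. by move=> fi; have := integrable_norm fi; apply. Qed.

Lemma itgD a b f g : intg a b f -> intg a b g ->
  itg a b (fun x => f x + g x) = itg a b f + itg a b g.
Proof. by move=> fi gi; exact: RintegralD. Qed.

Lemma itgB a b f g : intg a b f -> intg a b g ->
  itg a b (fun x => f x - g x) = itg a b f - itg a b g.
Proof. by move=> fi gi; exact: RintegralB. Qed.

Lemma itgZ a b k f : intg a b f -> itg a b (fun x => k * f x) = k * itg a b f.
Proof. by move=> fi; exact: RintegralZl. Qed.

Lemma itg_cst a b k : a <= b -> itg a b (fun=> k) = k * (b - a).
Proof.
move=> ab; rewrite /itg Rintegral_cst//= lebesgue_measure_itv/= lte_fin.
by case: ltgtP ab => // ->; rewrite subrr.
Qed.

Lemma le_itg a b f g : intg a b f -> intg a b g ->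
  (forall x, a <= x <= b -> f x <= g x) -> itg a b f <= itg a b g.
Proof.
move=> fi gi fg; apply: le_Rintegral => // x; rewrite /= in_itv/=; exact: fg.
Qed.

Lemma itg_ge0 a b f : (forall x, a <= x <= b -> 0 <= f x) -> 0 <= itg a b f.
Proof. by move=> f0; apply: Rintegral_ge0 => x; rewrite /= in_itv/=; exact: f0. Qed.

Lemma norm_itg a b f : intg a b f -> `|itg a b f| <= itg a b (fun x => `|f x|).
Proof. by move=> fi; exact: le_normr_Rintegral. Qed.

Lemma itg_norm_sub a b a' b' f : a <= a' -> a' <= b' -> b' <= b -> intg a b f ->
  itg a' b' (fun x => `|f x|) <= itg a b (fun x => `|f x|).
Proof.
move=> aa ab bb /intg_norm fi.
rewrite (@itg_chasles a a' b)// ?(le_trans ab)//.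
rewrite (@itg_chasles a' b' b)//; last exact: intg_sub fi.
rewrite addrCA lerDl addr_ge0// itg_ge0//.
Qed.

Lemma intg_cst a b k : intg a b (fun=> k).
Proof.
apply: continuous_compact_integrable; first exact: segment_compact.
by apply: continuous_subspaceT => x; exact: cvg_cst.
Qed.

Lemma bmf_cont a b f : {within `[a, b], continuous f} -> bmf a b f.
Proof.
move=> fc; split.
  exact: subspace_continuous_measurable_fun.
have [ba|ab] := ltP b a.
  by exists 0 => x /andP[ax xb]; have := le_trans ax xb; rewrite leNgt ba.
have := @EVT_max R (fun x => `|f x|) a b ab.
case.
  move=> x; apply: continuous_comp; first exact: fc.
  exact: norm_continuous.
by move=> c _ Hc; exists (`|f c|) => x xab; apply: Hc; rewrite in_itv.
Qed.

Lemma bmf_sub a b a' b' f : a <= a' -> b' <= b -> bmf a b f -> bmf a' b' f.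
Proof.
move=> aa bb [mf [C HC]]; split.
  apply: measurable_funS mf => //.
  by apply: subset_itv; rewrite ?bnd_simp.
exists C => x /andP[ax xb]; apply: HC.
by rewrite (le_trans aa)//= (le_trans xb).
Qed.

Lemma bmfM a b f g : bmf a b f -> bmf a b g -> bmf a b (fun x => f x * g x).
Proof.
move=> [mf [C HC]] [mg [D HD]]; split; first exact: measurable_funM.
by exists (C * D) => x xab; rewrite normrM ler_pM// ?HC ?HD.
Qed.

Lemma bmfD a b f g : bmf a b f -> bmf a b g -> bmf a b (fun x => f x + g x).
Proof.
move=> [mf [C HC]] [mg [D HD]]; split; first exact: measurable_funD.
by exists (C + D) => x xab; rewrite (le_trans (ler_normD _ _))// lerD ?HC ?HD.
Qed.

Lemma bmf_cst a b k : bmf a b (fun=> k).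
Proof. by split; [exact: measurable_cst|exists `|k|]. Qed.

Lemma bmfZ a b k f : bmf a b f -> bmf a b (fun x => k * f x).
Proof. by apply: bmfM; exact: bmf_cst. Qed.

Lemma bmfB a b f g : bmf a b f -> bmf a b g -> bmf a b (fun x => f x - g x).
Proof.
move=> bf /(bmfZ (-1)) /(bmfD bf).
by under eq_fun do rewrite mulN1r.
Qed.

Lemma intgM a b f g : intg a b f -> bmf a b g -> intg a b (fun x => f x * g x).
Proof.
move=> fi [mg [C HC]]; suff : mu.-integrable `[a, b] ((EFin \o f) \* (EFin \o g))%E by [].
apply: integrableMl => //.
exists C; split; first exact: num_real.
move=> M CM x; rewrite /= in_itv/= => /HC /le_trans; apply; exact: ltW.
Qed.

Lemma intg_bmf a b f : bmf a b f -> intg a b f.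
Proof.
move=> /(intgM (intg_cst a b 1)); apply: eq_intg => x _; exact: mul1r.
Qed.

(** For [f] integrable: [F] is absolutely continuous on [[a, b]], and its
    derivative is [f] almost everywhere. *)
Definition prim a b F f := forall x, a <= x <= b -> F x = F a + itg a x f.

Lemma prim_cont a b F f : a <= b -> intg a b f -> prim a b F f ->
  {within `[a, b], continuous F}.
Proof.
move=> ab fi FE.
apply: (@subspace_eq_continuous _ _ _ (fun x => F a + itg a x f)) => [x|].
  by rewrite /= inE/= in_itv/= => /FE.
have := @parameterized_integral_continuous R a b f ab fi.
move=> + x => /(_ x) H.
by apply: cvgD; [exact: cvg_cst|exact: H].
Qed.

Lemma prim_bmf a b F f : a <= b -> intg a b f -> prim a b F f -> bmf a b F.
Proof. by move=> ab fi /(prim_cont ab fi) /bmf_cont. Qed.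

Lemma primB a b F f x y : intg a b f -> prim a b F f ->
  a <= x -> x <= y -> y <= b -> F y - F x = itg x y f.
Proof.
move=> fi FE ax xy yb.
rewrite (FE y) ?(le_trans ax)// (FE x) ?ax ?(le_trans xy)//.
rewrite (@itg_chasles a x y)//; first by ring.
exact: intg_sub fi.
Qed.

Lemma prim_sub a b a' b' F f : a <= a' -> b' <= b -> intg a b f ->
  prim a b F f -> prim a' b' F f.
Proof.
move=> aa bb fi FE x /andP[ax xb].
by rewrite -(primB fi FE aa ax (le_trans xb bb)) addrCA subrr addr0.
Qed.

Lemma primD a b F f G g : intg a b f -> intg a b g -> prim a b F f ->
  prim a b G g -> prim a b (fun x => F x + G x) (fun x => f x + g x).
Proof.
move=> fi gi FE GE x /andP[ax xb].
rewrite FE ?ax// GE ?ax// itgD; [ring| |]; exact: intg_sub xb _.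
Qed.

Lemma primZ a b k F f : intg a b f -> prim a b F f ->
  prim a b (fun x => k * F x) (fun x => k * f x).
Proof.
move=> fi FE x /andP[ax xb].
rewrite FE ?ax// itgZ; [ring|]; exact: intg_sub xb _.
Qed.

(** Cut [[a, b]] into [n] equal parts and add up: the increments of [Phi]
    telescope, and the factor [y - x] contributes [(b - a) / n]. *)
Lemma flat_cst a b C (H Phi : R -> R) : a <= b -> 0 <= C ->
  (forall x y, a <= x -> x <= y -> y <= b ->
    `|H y - H x| <= C * (y - x) * (Phi y - Phi x)) -> H b = H a.
Proof.
move=> ab C0 HP.
have key n : `|H b - H a| * n.+1%:R <= C * (b - a) * (Phi b - Phi a).
  pose d := (b - a) / n.+1%:R; pose t i := a + i%:R * d.
  have d0 : 0 <= d by rewrite divr_ge0// subr_ge0.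
  have t0 : t 0%N = a by rewrite /t mul0r addr0.
  have tn : t n.+1 = b.
    by rewrite /t /d mulrCA divff ?pnatr_eq0// mulr1; ring.
  have tS i : t i.+1 - t i = d by rewrite /t -natr1; ring.
  have tge i : a <= t i by rewrite /t lerDl mulr_ge0.
  have tle i : (i <= n.+1)%N -> t i <= b.
    by move=> ile; rewrite -tn /t lerD2l ler_wpM2r// ler_nat.
  have step (k : nat) : (k <= n.+1)%N ->
      `|H (t k) - H (t 0%N)| <= C * d * (Phi (t k) - Phi (t 0%N)).
    elim: k => [_|k IH kn]; first by rewrite !subrr normr0 mulr0.
    have kn' : (k <= n.+1)%N by exact: ltnW.
    have tkS : t k <= t k.+1 by rewrite -subr_ge0 tS.
    have := HP _ _ (tge k) tkS (tle _ kn); rewrite tS => H1.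
    have H2 := IH kn'.
    have := ler_normD (H (t k.+1) - H (t k)) (H (t k) - H (t 0%N)).
    rewrite addrA subrK => /le_trans; apply.
    apply: le_trans (lerD H1 H2) _.
    by rewrite le_eqVlt; apply/predU1P; left; ring.
  have := step n.+1 (leqnn _); rewrite tn t0 => st.
  rewrite -ler_pdivlMr//; apply: le_trans st _.
  by rewrite le_eqVlt /d; apply/predU1P; left; ring.
apply/eqP; rewrite -subr_eq0 -normr_le0 leNgt; apply/negP => H0.
set B := C * (b - a) * _ in key.
have [B0|B0] := leP B 0.
  by have := key 0%N; rewrite mulr1; lra.
have [n] : exists n : nat, B / `|H b - H a| < n%:R.
  by exists (Num.bound (B / `|H b - H a|)); apply: archi_boundP; rewrite divr_ge0// ltW.
rewrite ltr_pdivrMr// => B1.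
have := key n; rewrite -natr1 mulrDr mulr1 => B2.
lra.
Qed.

(** The defect [H] of the formula on [[a, x]] is shown to be flat. Over [[x, y]]
    it grows by the integrals of [f (G y - G)] and of [(F x - F) g], where
    [|G y - G| <= C (y - x)], [|g| <= C], and [|F x - F|] is at most the increment
    of the integral of [|f|]. So each of the two is at most [C (y - x)] times that
    increment. *)
Lemma int_by_parts a b F f G g : a <= b -> intg a b f -> bmf a b g ->
  prim a b F f -> prim a b G g ->
  F b * G b - F a * G a = itg a b (fun x => f x * G x) + itg a b (fun x => F x * g x).
Proof.
move=> ab fi bg FE GE.
have gi := intg_bmf bg.
have bF := prim_bmf ab fi FE; have bG := prim_bmf ab gi GE.
have [mg [C HC]] := bg.
have C0 : 0 <= C by apply: le_trans (HC a _) => //; rewrite lexx.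
have fGi : intg a b (fun x => f x * G x) by exact: intgM.
have Fgi : intg a b (fun x => F x * g x) by exact/intg_bmf/bmfM.
pose H x := F x * G x - (itg a x (fun x => f x * G x) + itg a x (fun x => F x * g x)).
suff : H b = H a by rewrite /H !itgxx => HH; lra.
apply: (@flat_cst a b (2 * C) H (fun x => itg a x (fun t => `|f t|))) => //.
  by rewrite mulr_ge0.
move=> x y ax xy yb; have fi' := intg_norm fi.
have ay : a <= y by exact: le_trans xy.
have sub h : intg a b h -> intg x y h by exact: intg_sub.
have suba h : intg a b h -> intg a y h by exact: intg_sub.
have -> : itg a y (fun t => `|f t|) - itg a x (fun t => `|f t|) = itg x y (fun t => `|f t|).
  by rewrite (itg_chasles ax xy (suba _ fi')); ring.
have Gd t s : x <= t -> t <= s -> s <= y -> `|G s - G t| <= C * (y - x).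
  move=> xt ts sy.
  rewrite (primB gi GE (le_trans ax xt) ts (le_trans sy yb)).
  have gi' : intg t s g by apply: intg_sub gi; [exact: le_trans xt|exact: le_trans yb].
  apply: le_trans (norm_itg gi') _.
  apply: (@le_trans _ _ (itg t s (fun=> C))).
    apply: le_itg; [exact: intg_norm|exact: intg_cst|].
    move=> z /andP[tz zs]; apply: HC.
    by rewrite (le_trans (le_trans ax xt) tz) (le_trans zs (le_trans sy yb)).
  rewrite itg_cst//; apply: ler_wpM2l => //; lra.
have Fd t : x <= t -> t <= y -> `|F x - F t| <= itg x y (fun t => `|f t|).
  move=> xt ty; rewrite distrC (primB fi FE ax xt (le_trans ty yb)).
  have fi2 : intg x t f by apply: intg_sub fi => //; exact: le_trans yb.
  apply: le_trans (norm_itg fi2) _; apply: itg_norm_sub => //; exact: sub.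
have -> : H y - H x = itg x y (fun t => f t * (G y - G t)) + itg x y (fun t => (F x - F t) * g t).
  have -> : itg x y (fun t => f t * (G y - G t)) = G y * (F y - F x) - itg x y (fun t => f t * G t).
    rewrite (primB fi FE ax xy yb) -itgZ ?sub// -itgB ?sub//; last first.
      exact: intgZ.
    by apply: eq_itg => t _; ring.
  have -> : itg x y (fun t => (F x - F t) * g t) = F x * (G y - G x) - itg x y (fun t => F t * g t).
    rewrite (primB gi GE ax xy yb) -itgZ ?sub// -itgB ?sub//; last first.
      exact: intgZ.
    by apply: eq_itg => t _; ring.
  rewrite /H (itg_chasles ax xy (suba _ fGi)) (itg_chasles ax xy (suba _ Fgi)).
  by ring.
have -> : 2 * C * (y - x) * itg x y (fun t => `|f t|) =
  itg x y (fun t => C * (y - x) * `|f t|) + itg x y (fun t => C * itg x y (fun t => `|f t|)).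
  by rewrite itgZ ?sub// itg_cst//; ring.
apply: le_trans (ler_normD _ _) _; apply: lerD.
  have i1 : intg x y (fun t => f t * (G y - G t)).
    apply: sub; apply: intgM => //; apply: bmfB => //; exact: bmf_cst.
  apply: le_trans (norm_itg i1) _; apply: le_itg.
  - exact: intg_norm.
  - by apply: intgZ; exact: sub.
  - move=> t /andP[xt ty]; rewrite normrM mulrC ler_wpM2r//; exact: Gd.
have i2 : intg x y (fun t => (F x - F t) * g t).
  apply/sub/intg_bmf; apply: bmfM => //; apply: bmfB => //; exact: bmf_cst.
apply: le_trans (norm_itg i2) _; apply: le_itg.
- exact: intg_norm.
- exact: intg_cst.
- move=> t /andP[xt ty]; rewrite normrM mulrC; apply: ler_pM => //; last exact: Fd.
  by apply: HC; rewrite (le_trans ax xt) (le_trans ty yb).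
Qed.

End interval_integrals.

(** * Boundary value problems on a short interval *)

Section sturm_liouville.
Context {R : realType}.
Implicit Types (a b c k x y A B C M : R) (f g u v Q P : R -> R).

(** [u'' = Q u] on [[a, b]] in integrated form, with [u1] for [u']. Boundedness
    and measurability of [u] make [Q u] integrable as soon as [Q] is. *)
Definition sol Q a b u u1 := [/\ bmf a b u, bmf a b u1, prim a b u u1 &
  prim a b u1 (fun t => Q t * u t)].

(** Apply the hypothesis with [M] the supremum of [|f|]. *)
Lemma bmf_half a b f A : a <= b -> bmf a b f ->
  (forall M, (forall x, a <= x <= b -> `|f x| <= M) ->
     forall x, a <= x <= b -> `|f x| <= A + M / 2) ->
  forall x, a <= x <= b -> `|f x| <= 2 * A.
Proof.
move=> ab [_ [C HC]] H.
pose E := [set `|f x| | x in `[a, b]].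
have hs : has_sup E.
  split; first by exists `|f a|, a => //; rewrite /= in_itv/= lexx.
  by exists C => _ [x + <-]; rewrite /= in_itv/=; exact: HC.
have lesup x : a <= x <= b -> `|f x| <= sup E.
  by move=> xab; apply: ub_le_sup; [case: hs|exists x => //; rewrite /= in_itv].
have : sup E <= A + sup E / 2.
  apply: ge_sup; first by case: hs.
  by move=> _ [x + <-]; rewrite /= in_itv/=; exact: H.
move=> sE x /lesup; lra.
Qed.

Section piece.
Variables (Q : R -> R) (a b : R).
Hypotheses (ab : a < b) (Qi : intg a b Q)
  (small : (b - a) * itg a b (fun t => `|Q t|) <= 4^-1).

(* [T u] solves [(T u)'' = Q u] with zero initial data at [a]; since the interval is
   short, it is at most a quarter of [u] in supremum norm. *)
Let V u x := itg a x (fun s => Q s * u s).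
Let T u x := itg a x (V u).

Let Qui u : bmf a b u -> intg a b (fun s => Q s * u s).
Proof. exact: intgM. Qed.

Let Vprim u : prim a b (V u) (fun s => Q s * u s).
Proof. by move=> x _; rewrite /V itgxx add0r. Qed.

Let bV u : bmf a b u -> bmf a b (V u).
Proof. by move=> bu; apply: prim_bmf (Qui bu) (@Vprim u); exact: ltW. Qed.

Let Tprim u : prim a b (T u) (V u).
Proof. by move=> x _; rewrite /T itgxx add0r. Qed.

Let bT u : bmf a b u -> bmf a b (T u).
Proof.
by move=> bu; apply: prim_bmf (@Tprim u); [exact: ltW|exact/intg_bmf/bV].
Qed.

Let T_bound u M : bmf a b u -> (forall x, a <= x <= b -> `|u x| <= M) ->
  forall x, a <= x <= b -> `|T u x| <= M / 4.
Proof.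
move=> bu uM x /andP[ax xb].
have M0 : 0 <= M by apply: le_trans (normr_ge0 _) (uM a _); rewrite lexx ltW.
have VM t : a <= t <= x -> `|V u t| <= M * itg a b (fun t => `|Q t|).
  move=> /andP[at_ tx]; have tb := le_trans tx xb.
  have i1 : intg a t (fun s => Q s * u s) by exact: intg_sub (Qui bu).
  apply: le_trans (norm_itg i1) _.
  apply: (@le_trans _ _ (itg a t (fun s => M * `|Q s|))).
    apply: le_itg; first exact: intg_norm.
      by apply: intgZ; apply: intg_norm; exact: intg_sub Qi.
    move=> s /andP[as_ st]; rewrite normrM mulrC ler_wpM2r// uM//.
    by rewrite as_ (le_trans st).
  rewrite itgZ; last by apply: intg_norm; exact: intg_sub Qi.
  by rewrite ler_wpM2l//; exact: itg_norm_sub.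
have i2 : intg a x (V u) by apply: intg_sub (intg_bmf (bV bu)).
apply: le_trans (norm_itg i2) _.
apply: (@le_trans _ _ (itg a x (fun=> M * itg a b (fun t => `|Q t|)))).
  by apply: le_itg => //; [exact: intg_norm|exact: intg_cst].
rewrite itg_cst//.
have I0 : 0 <= itg a b (fun t => `|Q t|) by exact: itg_ge0.
have : M * itg a b (fun t => `|Q t|) * (x - a) <= M * itg a b (fun t => `|Q t|) * (b - a).
  by apply: ler_wpM2l; [exact: mulr_ge0|lra].
have := ler_wpM2l M0 small; lra.
Qed.

Let TB u v x : bmf a b u -> bmf a b v -> a <= x <= b ->
  T u x - T v x = T (fun t => u t - v t) x.
Proof.
move=> bu bv /andP[ax xb].
have sub g t : t <= b -> intg a b g -> intg a t g by exact: intg_sub.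
rewrite /T -itgB; [|by apply: sub => //; exact/intg_bmf/bV..].
apply: eq_itg => t /andP[_ tx]; have tb := le_trans tx xb.
rewrite /V -itgB; [|by apply: sub => //; exact: Qui..].
by apply: eq_itg => s _; ring.
Qed.

(** [u] is the affine interpolation of its boundary values, plus [T u], minus the
    affine function that corrects the boundary value of [T u] at [b]. The last two
    terms are at most half the supremum of [|u|], so they can be absorbed. This
    also gives uniqueness for given boundary values. *)
Lemma sol_bound u u1 : sol Q a b u u1 ->
  forall x, a <= x <= b -> `|u x| <= 2 * (`|u a| + `|u b|).
Proof.
move=> [bu bu1 uE u1E]; apply: bmf_half => //; first exact: ltW.
move=> M uM x xab; have /andP[ax xb] := xab.
have uT y : a <= y <= b -> u y = u a + (y - a) * u1 a + T u y.
  move=> /andP[ay yb]; rewrite uE ?ay// (@eq_itg _ _ _ u1 (fun t => u1 a + V u t)).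
    rewrite itgD ?itg_cst//; [by rewrite /T; ring|exact: intg_cst|].
    exact: intg_sub yb (intg_bmf (bV bu)).
  by move=> t /andP[at_ ty]; rewrite u1E// at_ (le_trans ty).
have bab : a <= b <= b by rewrite lexx ltW.
have d0 : 0 < b - a by rewrite subr_gt0.
pose s := (x - a) / (b - a).
have s0 : 0 <= s by rewrite divr_ge0//; lra.
have s1 : s <= 1 by rewrite ler_pdivrMr//; lra.
have -> : u x = (1 - s) * u a + s * u b + (T u x - s * T u b).
  rewrite (uT x)// (uT b)// /s; field; lra.
have H1 := T_bound bu uM xab; have H2 := T_bound bu uM bab.
have M0 : 0 <= M by apply: le_trans (normr_ge0 _) (uM a _); rewrite lexx ltW.
apply: le_trans (ler_normD _ _) _.
apply: lerD.
  apply: le_trans (ler_normD _ _) _; rewrite (normrM (1 - s)) (normrM s); apply: lerD.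
    by rewrite ger0_norm ?subr_ge0// ler_piMl//; lra.
  by rewrite (ger0_norm s0) ler_piMl.
apply: le_trans (ler_normB _ _) _.
have : `|s * T u b| <= M / 4.
  by rewrite (normrM s) (ger0_norm s0) (le_trans _ H2)// ler_piMl.
lra.
Qed.

(** Picard iteration: the map [S] below adds to [T u] the affine function that
    restores the boundary values [A] and [B], and it is a contraction with
    factor 1/2. *)
Lemma sol_exists A B : exists u u1, [/\ sol Q a b u u1, u a = A & u b = B].
Proof.
have d0 : 0 < b - a by rewrite subr_gt0.
have bab : a <= b <= b by rewrite lexx ltW.
pose S u x := A + (x - a) / (b - a) * (B - A - T u b) + T u x.
have bS u : bmf a b u -> bmf a b (S u).
  move=> bu; apply: bmfD; last exact: bT.
  apply: bmfD; first exact: bmf_cst.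
  apply: bmfM; last exact: bmf_cst.
  apply: bmfM; last exact: bmf_cst.
  apply: bmfB; last exact: bmf_cst.
  by apply: bmf_cont; apply: continuous_subspaceT => x; exact: cvg_id.
have S_contr u v M : bmf a b u -> bmf a b v ->
    (forall x, a <= x <= b -> `|u x - v x| <= M) ->
    forall x, a <= x <= b -> `|S u x - S v x| <= M / 2.
  move=> bu bv uvM x xab; have /andP[ax xb] := xab.
  pose s := (x - a) / (b - a).
  have s0 : 0 <= s by rewrite divr_ge0//; lra.
  have s1 : s <= 1 by rewrite ler_pdivrMr//; lra.
  have H1 := T_bound (bmfB bu bv) uvM xab.
  have H2 := T_bound (bmfB bu bv) uvM bab.
  rewrite -TB// in H1; rewrite -TB// in H2.
  have -> : S u x - S v x = (T u x - T v x) - s * (T u b - T v b).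
    rewrite /S -/s; move: (T u x) (T v x) (T u b) (T v b) => tu tv tub tvb.
    by ring.
  apply: le_trans (ler_normB _ _) _.
  have : `|s * (T u b - T v b)| <= M / 4.
    by rewrite (normrM s) (ger0_norm s0) (le_trans _ H2)// ler_piMl.
  lra.
pose y n := iter n S (fun=> 0).
have by_ n : bmf a b (y n) by elim: n => [|n IH]; [exact: bmf_cst|exact: bS].
have [M0 yM0] : exists M0, forall x, a <= x <= b -> `|y 1%N x - y 0%N x| <= M0.
  by have [_ ] := bmfB (by_ 1%N) (by_ 0%N).
have stp n x : a <= x <= b -> `|y n.+1 x - y n x| <= M0 / 2 ^+ n.
  elim: n x => [|n IH] x xab; first by rewrite expr0 divr1 yM0.
  rewrite exprS invfM mulrCA mulrC.
  exact: (S_contr (y n.+1) (y n) (M0 / 2 ^+ n)).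
have M00 : 0 <= M0 by apply: le_trans (normr_ge0 _) (yM0 a _); rewrite lexx ltW.
have tail n m x : a <= x <= b -> `|y (n + m)%N x - y n x| <= 2 * M0 / 2 ^+ n.
  move=> xab.
  have : `|y (n + m)%N x - y n x| <= (2 - 2 / 2 ^+ m) * M0 / 2 ^+ n.
    elim: m => [|m IH]; first by rewrite addn0 subrr normr0 expr0; lra.
    have := stp (n + m)%N x xab; rewrite addnS => H1.
    have := ler_normD (y (n + m).+1 x - y (n + m)%N x) (y (n + m)%N x - y n x).
    rewrite addrA subrK => /le_trans; apply.
    apply: le_trans (lerD H1 IH) _; rewrite le_eqVlt; apply/predU1P; left.
    rewrite exprD exprS; field.
    by rewrite !expf_neq0// pnatr_eq0.
  move=> /le_trans; apply; rewrite ler_wpM2r ?invr_ge0 ?exprn_ge0//.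
  rewrite ler_wpM2r// gerBl divr_ge0// exprn_ge0//.
have yc x : a <= x <= b -> cvgn (fun n => y n x).
  move=> xab.
  have : cvgn (series (fun n => y n.+1 x - y n x)).
    apply: normed_cvg; apply: (@series_le_cvg _ _ (geometric M0 2^-1)).
    - by move=> n; exact: normr_ge0.
    - by move=> n; rewrite /= mulr_ge0// exprn_ge0// invr_ge0.
    - by move=> n; rewrite /= exprVn; exact: stp.
    - by apply: is_cvg_geometric_series; rewrite ger0_norm; lra.
  have -> : series (fun n => y n.+1 x - y n x) = (fun n => y n x).
    apply/funext => n; rewrite /series/= telescope_sumr//.
    by rewrite /y/= subr0.
  by [].
pose u x := limn (fun n => y n x).
have uy n x : a <= x <= b -> `|u x - y n x| <= 2 * M0 / 2 ^+ n.
  move=> xab.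
  have cu : (fun m => `|y m x - y n x|) @ \oo --> `|u x - y n x|.
    apply: cvg_norm; apply: cvgB; [exact: yc|exact: cvg_cst].
  rewrite -(cvg_lim _ cu)//; apply: limr_le; first by apply/cvg_ex; exists (`|u x - y n x|).
  near=> m; have nm : (n <= m)%N by near: m; exact: nbhs_infty_ge.
  by rewrite -(subnKC nm); exact: tail.
have bu : bmf a b u.
  split; last first.
    have [_ [C HC]] := by_ 0%N.
    exists (C + 2 * M0 / 2 ^+ 0) => x xab.
    have := uy 0%N x xab; have := HC x xab.
    have := ler_normD (u x - y 0%N x) (y 0%N x); rewrite subrK; lra.
  apply: (@measurable_fun_cvg _ _ _ _ y) => [n|x].
    by case: (by_ n).
  by rewrite /= in_itv/= => /yc.
have uS x : a <= x <= b -> u x = S u x.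
  move=> xab; apply/eqP; rewrite -subr_eq0 -normr_le0.
  have bnd n : `|u x - S u x| <= 2 * M0 / 2 ^+ n.
    have n2 : 2 ^+ n != 0 :> R by rewrite expf_neq0// pnatr_eq0.
    have H1 := uy n.+1 x xab.
    have H2 : `|S u x - y n.+1 x| <= 2 * M0 / 2 ^+ n / 2.
      by apply: (S_contr u (y n)) => // z; exact: uy.
    have := ler_normB (u x - y n.+1 x) (S u x - y n.+1 x).
    rewrite opprB addrA subrK => /le_trans; apply.
    apply: le_trans (lerD H1 H2) _; rewrite exprS le_eqVlt; apply/predU1P; left.
    by field.
  have cz : (fun n => 2 * M0 / 2 ^+ n) @ \oo --> 0.
    have -> : (fun n => 2 * M0 / 2 ^+ n) = geometric (2 * M0) 2^-1.
      by apply/funext => n; rewrite /= exprVn.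
    by apply: cvg_geometric; rewrite ger0_norm; lra.
  rewrite -(cvg_lim _ cz)//; apply: limr_ge; first by apply/cvg_ex; exists 0.
  by near=> n; exact: bnd.
have Ta : T u a = 0 by rewrite /T itgxx.
have ua : u a = A by rewrite uS ?lexx ?ltW// /S Ta; field; lra.
have ub : u b = B by rewrite uS// /S; field; lra.
pose sl := (B - A - T u b) / (b - a).
exists u, (fun x => sl + V u x); split => //; split => //.
- by apply: bmfD; [exact: bmf_cst|exact: bV].
- move=> x /andP[ax xb]; rewrite itgD ?itg_cst//; [|exact: intg_cst|].
    by rewrite ua uS ?ax// /S /sl /T; field; lra.
  exact: intg_sub xb (intg_bmf (bV bu)).
- by move=> x xab; rewrite {2}/V itgxx addr0.
Unshelve. all: by end_near. Qed.

End piece.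

End sturm_liouville.

(** * Energy identities *)

Section energy.
Context {R : realType}.
Implicit Types (a b c k x y A B C M : R) (f g u v Q P : R -> R).

Lemma intg_sqr a b f : bmf a b f -> intg a b (fun t => f t ^+ 2).
Proof. by move=> bf; apply: intg_bmf; exact: bmfM. Qed.

(** The inequality of Cauchy and Schwarz, read off from the integral of the
    squared deviation of [f] from its mean. *)
Lemma prim_sqr a b F f x y : bmf a b f -> prim a b F f ->
  a <= x <= b -> a <= y <= b ->
  (F y - F x) ^+ 2 <= (b - a) * itg a b (fun t => f t ^+ 2).
Proof.
move=> bf FE; wlog xy : x y / x <= y => [H xab yab|].
  have [xy|yx] := leP x y; first exact: H.
  by rewrite -opprB sqrrN; apply: H => //; exact: ltW.
move=> /andP[ax _] /andP[_ yb].
have f2 := intg_sqr bf; have fi := intg_bmf bf.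
have sub h : intg a b h -> intg x y h by exact: intg_sub.
rewrite (primB fi FE ax xy yb).
have J0 : 0 <= itg x y (fun t => f t ^+ 2) by apply: itg_ge0 => t _; exact: sqr_ge0.
have JJ : itg x y (fun t => f t ^+ 2) <= itg a b (fun t => f t ^+ 2).
  rewrite (@eq_itg _ x y _ (fun t => `|f t ^+ 2|)); last first.
    by move=> t _; rewrite ger0_norm// sqr_ge0.
  rewrite (@eq_itg _ a b _ (fun t => `|f t ^+ 2|)); last first.
    by move=> t _; rewrite ger0_norm// sqr_ge0.
  exact: itg_norm_sub.
have : itg x y f ^+ 2 <= (y - x) * itg x y (fun t => f t ^+ 2).
  set s := itg x y f.
  have [xy'|ne] := eqVneq x y.
    by rewrite /s -xy' itgxx subrr mul0r expr0n.
  have d0 : 0 < y - x by rewrite subr_gt0 lt_neqAle ne.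
  have : 0 <= itg x y (fun t => (f t - s / (y - x)) ^+ 2).
    by apply: itg_ge0 => t _; exact: sqr_ge0.
  rewrite (@eq_itg _ x y _ (fun t => f t ^+ 2 - (2 * (s / (y - x)) * f t - (s / (y - x)) ^+ 2))); last first.
    by move=> t _; ring.
  rewrite itgB; [|exact: sub|]; last first.
    by apply: intgB; [apply: intgZ; exact: sub|exact: intg_cst].
  rewrite itgB; [|by apply: intgZ; exact: sub|exact: intg_cst].
  rewrite itgZ ?sub// itg_cst// -/s => H.
  have := ler_wpM2l (ltW d0) H; rewrite mulr0.
  suff -> : (y - x) * (itg x y (fun t => f t ^+ 2) -
    (2 * (s / (y - x)) * s - (s / (y - x)) ^+ 2 * (y - x))) =
    (y - x) * itg x y (fun t => f t ^+ 2) - s ^+ 2 by lra.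
  by field; lra.
move=> /le_trans; apply; apply: ler_pM => //; lra.
Qed.

Lemma energyE Q a b u u1 : a <= b -> intg a b Q -> sol Q a b u u1 ->
  u1 b * u b - u1 a * u a =
  itg a b (fun t => u1 t ^+ 2) + itg a b (fun t => Q t * u t ^+ 2).
Proof.
move=> ab Qi [bu bu1 uE u1E].
have Qui : intg a b (fun t => Q t * u t) by exact: intgM.
rewrite (int_by_parts ab Qui bu1 u1E uE) addrC; congr (_ + _).
by apply: eq_itg => t _; ring.
Qed.

Lemma green Q P a b u u1 v v1 : a <= b -> intg a b Q -> intg a b P ->
  sol Q a b u u1 -> sol P a b v v1 ->
  (u1 b * v b - u1 a * v a) - (v1 b * u b - v1 a * u a) =
  itg a b (fun t => (Q t - P t) * (u t * v t)).
Proof.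
move=> ab Qi Pi [bu bu1 uE u1E] [bv bv1 vE v1E].
have Qui : intg a b (fun t => Q t * u t) by exact: intgM.
have Pvi : intg a b (fun t => P t * v t) by exact: intgM.
rewrite (int_by_parts ab Qui bv1 u1E vE) (int_by_parts ab Pvi bu1 v1E uE).
rewrite (@eq_itg _ _ _ (fun x => v1 x * u1 x) (fun x => u1 x * v1 x)); last first.
  by move=> t _; rewrite mulrC.
rewrite opprD addrACA subrr addr0 -itgB; [|exact: intgM..].
by apply: eq_itg => t _; ring.
Qed.

Lemma sup_energy a b w w1 : prim a b w w1 -> bmf a b w1 -> a <= b ->
  w a = 0 ->
  forall x, a <= x <= b -> w x ^+ 2 <= (b - a) * itg a b (fun t => w1 t ^+ 2).
Proof.
move=> wE bw1 ab wa x xab.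
by have := prim_sqr bw1 wE (_ : a <= a <= b) xab; rewrite wa subr0 lexx; apply.
Qed.

Lemma itg_Qsqr Q a b w M : a <= b -> intg a b Q -> bmf a b w ->
  (forall x, a <= x <= b -> w x ^+ 2 <= M) ->
  - (M * itg a b (fun t => `|Q t|)) <= itg a b (fun t => Q t * w t ^+ 2).
Proof.
move=> ab Qi bw wM.
have bw2 : bmf a b (fun t => w t ^+ 2) by exact: bmfM.
rewrite lerNl.
have i1 : intg a b (fun t => Q t * w t ^+ 2) by exact: intgM.
apply: le_trans (_ : `|itg a b (fun t => Q t * w t ^+ 2)| <= _).
  by rewrite -normrN ler_norm.
apply: le_trans (norm_itg i1) _; rewrite -itgZ; last exact: intg_norm.
apply: le_itg; [exact: intg_norm|by apply: intgZ; exact: intg_norm|].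
move=> x xab; rewrite normrM mulrC ler_wpM2r// ger0_norm ?sqr_ge0//; exact: wM.
Qed.

(** A function that vanishes at [a] satisfies [w ^ 2 <= (b - a) int w1 ^ 2], so on
    a short interval the potential term is dominated by the kinetic one. *)
Lemma dirichlet_energy Q a b w w1 : a <= b -> intg a b Q ->
  (b - a) * itg a b (fun t => `|Q t|) <= 1 ->
  prim a b w w1 -> bmf a b w1 -> w a = 0 ->
  0 <= itg a b (fun t => w1 t ^+ 2) + itg a b (fun t => Q t * w t ^+ 2).
Proof.
move=> ab Qi small wE bw1 wa.
have bw := prim_bmf ab (intg_bmf bw1) wE.
have := itg_Qsqr ab Qi bw (sup_energy wE bw1 ab wa).
set J := itg a b (fun t => w1 t ^+ 2).
have J0 : 0 <= J by apply: itg_ge0 => t _; exact: sqr_ge0.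
have := ler_wpM2l J0 small; lra.
Qed.

(** [u] and [v] solve the equation for [m] and [lam] with the same boundary
    values, and the right-hand side is the difference of their boundary forms. By
    the identity of Green it equals [(lam - m) int u v]. With [w = u - v], which
    vanishes at both ends, [int u v = int u ^ 2 - int u w]; testing the equation of
    [w] with [w] itself shows that [- (lam - m) int u w] is the energy of [w],
    hence nonnegative. *)
Lemma flux_decr q a b lam m u u1 v v1 : a <= b -> intg a b q ->
  (b - a) * itg a b (fun t => `|q t - lam|) <= 1 ->
  sol (fun t => q t - m) a b u u1 -> sol (fun t => q t - lam) a b v v1 ->
  u a = v a -> u b = v b ->
  (lam - m) * itg a b (fun t => u t ^+ 2) <=
  (u1 b * u b - u1 a * u a) - (v1 b * v b - v1 a * v a).
Proof.
move=> ab qi small su sv uva uvb.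
have qi' k : intg a b (fun t => q t - k) by apply: intgB => //; exact: intg_cst.
have := green ab (qi' m) (qi' lam) su sv; rewrite -uva -uvb => ->.
have [bu bu1 uE u1E] := su; have [bv bv1 vE v1E] := sv.
pose w t := u t - v t; pose w1 t := u1 t - v1 t.
have bw : bmf a b w by exact: bmfB.
have bw1 : bmf a b w1 by exact: bmfB.
have wE : prim a b w w1.
  move=> x /andP[ax xb]; rewrite /w uE ?ax// vE ?ax// /w1 itgB; first by ring.
    exact: intg_sub xb (intg_bmf bu1).
  exact: intg_sub xb (intg_bmf bv1).
have gi k z : bmf a b z -> intg a b (fun t => (q t - k) * z t) by exact: intgM.
pose g t := (q t - m) * u t - (q t - lam) * v t.
have gint : intg a b g by apply: intgB; exact: gi.
have w1E : prim a b w1 g.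
  move=> x /andP[ax xb]; rewrite /w1 u1E ?ax// v1E ?ax// /g itgB; first by ring.
    exact: intg_sub xb (gi _ _ bu).
  exact: intg_sub xb (gi _ _ bv).
have wa : w a = 0 by rewrite /w uva subrr.
have wb : w b = 0 by rewrite /w uvb subrr.
have := int_by_parts ab gint bw1 w1E wE; rewrite wa wb !mulr0 subrr.
have E0 := dirichlet_energy ab (qi' lam) small wE bw1 wa.
have i1 : intg a b (fun t => (q t - lam) * w t ^+ 2) by apply: gi; exact: bmfM.
have uwi : intg a b (fun t => u t * w t) by apply: intg_bmf; exact: bmfM.
have -> : itg a b (fun x => g x * w x) = itg a b (fun t => (q t - lam) * w t ^+ 2) +
    (lam - m) * itg a b (fun t => u t * w t).
  rewrite -itgZ// -itgD//; last exact: intgZ.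
  by apply: eq_itg => t _; rewrite /g /w; ring.
have -> : itg a b (fun t => (q t - m - (q t - lam)) * (u t * v t)) =
  (lam - m) * itg a b (fun t => u t ^+ 2) - (lam - m) * itg a b (fun t => u t * w t).
  rewrite -!itgZ//; last exact: intg_sqr.
  rewrite -itgB; [|apply: intgZ; exact: intg_sqr|exact: intgZ].
  by apply: eq_itg => t _; rewrite /w; ring.
rewrite (@eq_itg _ _ _ (fun x => w1 x * w1 x) (fun t => w1 t ^+ 2)); last by [].
lra.
Qed.

(** Averaging [u x ^ 2 <= 2 u t ^ 2 + 2 (u x - u t) ^ 2] over [t] bounds the
    supremum of [u ^ 2] by the integrals of [u ^ 2] and [u1 ^ 2]. This controls
    the potential term: the kinetic term absorbs the second contribution because
    the interval is short, and [- lam int u ^ 2] absorbs the first. *)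
Lemma flux_low q a b K lam u u1 : a < b -> intg a b q ->
  itg a b (fun t => `|q t|) <= K -> 0 < K -> (b - a) * K <= 4^-1 ->
  4 * K <= (b - a) * - lam ->
  sol (fun t => q t - lam) a b u u1 ->
  2 * K * itg a b (fun t => u t ^+ 2) <=
  (b - a) * (u1 b * u b - u1 a * u a).
Proof.
move=> ab qi qK K0 small low su.
have qi' k : intg a b (fun t => q t - k) by apply: intgB => //; exact: intg_cst.
have ab' := ltW ab.
rewrite (energyE ab' (qi' lam) su).
have [bu bu1 uE u1E] := su.
set J := itg a b (fun t => u1 t ^+ 2); set I := itg a b (fun t => u t ^+ 2).
have J0 : 0 <= J by apply: itg_ge0 => t _; exact: sqr_ge0.
have I0 : 0 <= I by apply: itg_ge0 => t _; exact: sqr_ge0.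
have d0 : 0 < b - a by rewrite subr_gt0.
have u2i := intg_sqr bu.
have uM x : a <= x <= b -> u x ^+ 2 <= 2 / (b - a) * I + 2 * (b - a) * J.
  move=> xab.
  have : itg a b (fun=> u x ^+ 2) <= itg a b (fun t => 2 * u t ^+ 2 + 2 * ((b - a) * J)).
    apply: le_itg; first exact: intg_cst.
      by apply: intgD; [exact: intgZ|exact: intg_cst].
    move=> t tab; have := prim_sqr bu1 uE tab xab; rewrite -/J.
    have := sqr_ge0 (u x - 2 * u t); nra.
  rewrite itgD; [|exact: intgZ|exact: intg_cst].
  rewrite itgZ// !itg_cst// -/I => H.
  rewrite -(ler_pM2r d0); apply: le_trans H _.
  rewrite le_eqVlt; apply/predU1P; left; field; lra.
have i1 : intg a b (fun t => q t * u t ^+ 2) by apply: intgM => //; exact: bmfM.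
have -> : itg a b (fun t => (q t - lam) * u t ^+ 2) =
    itg a b (fun t => q t * u t ^+ 2) - lam * I.
  rewrite -itgZ// -itgB//; last exact: intgZ.
  by apply: eq_itg => t _; ring.
have := itg_Qsqr ab' qi bu uM.
set q0 := itg a b (fun t => `|q t|) in qK *.
set q2 := itg a b (fun t => q t * _).
set M := 2 / (b - a) * I + 2 * (b - a) * J => H.
have e0 := ltW d0.
have M0 : 0 <= M.
  rewrite /M; apply: addr_ge0; apply: mulr_ge0 => //; first exact: divr_ge0.
  exact: mulr_ge0.
have H1 : - (M * K) <= q2 by apply: le_trans H; rewrite lerN2 ler_wpM2l.
have H2 := ler_wpM2l (ltW d0) H1.
have H3 : (b - a) * - (M * K) = - (2 * K * I) - 2 * (b - a) * ((b - a) * K) * J.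
  by rewrite /M; field; lra.
have H4 : (b - a) * ((b - a) * K) * J <= (b - a) * 4^-1 * J.
  by rewrite ler_wpM2r// ler_wpM2l// ltW.
have H5 := ler_wpM2r I0 low.
have H6 : 0 <= (b - a) * J by rewrite mulr_ge0// ltW.
rewrite H3 in H2; lra.
Qed.

(** [u] is Lipschitz, so on an interval of length [d] around [x0] its square is
    at least [u x0 ^ 2 / 2 - (C d) ^ 2]. The integral there would be positive for
    small [d] if [u x0] were not zero. *)
Lemma itg_sqr_eq0 a b u u1 : a < b -> prim a b u u1 -> bmf a b u1 ->
  itg a b (fun t => u t ^+ 2) <= 0 -> forall x, a <= x <= b -> u x = 0.
Proof.
move=> ab uE bu1 I0 x0 /andP[ax xb].
have bu := prim_bmf (ltW ab) (intg_bmf bu1) uE.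
have [_ [C HC]] := bu1.
have C0 : 0 <= C by apply: le_trans (normr_ge0 _) (HC a _); rewrite lexx ltW.
have sqm (x y : R) : 0 <= x -> x <= y -> x ^+ 2 <= y ^+ 2.
  by move=> x1 xy; rewrite lerXn2r ?nnegrE// (le_trans x1).
have Lip x y : a <= x -> x <= y -> y <= b -> (u y - u x) ^+ 2 <= (C * (y - x)) ^+ 2.
  move=> ax' xy yb; rewrite (primB (intg_bmf bu1) uE)//.
  rewrite -[leLHS]real_normK ?num_real//.
  have i1 : intg x y u1 by apply: intg_sub (intg_bmf bu1).
  apply: sqm => //; apply: le_trans (norm_itg i1) _; rewrite -itg_cst//.
  apply: le_itg; [exact: intg_norm|exact: intg_cst|].
  by move=> t /andP[xt ty]; apply: HC; rewrite (le_trans ax')// (le_trans ty).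
have sub0 x y : a <= x -> x <= y -> y <= b -> itg x y (fun t => u t ^+ 2) <= 0.
  move=> ax' xy yb; apply: le_trans I0.
  rewrite (@eq_itg _ x y _ (fun t => `|u t ^+ 2|)); last first.
    by move=> t _; rewrite ger0_norm// sqr_ge0.
  rewrite (@eq_itg _ a b _ (fun t => `|u t ^+ 2|)); last first.
    by move=> t _; rewrite ger0_norm// sqr_ge0.
  by apply: itg_norm_sub => //; exact: intg_sqr.
have key x y : a <= x -> x <= x0 -> x0 <= y -> y <= b -> x < y ->
    u x0 ^+ 2 <= 2 * (C * (y - x)) ^+ 2.
  move=> ax' xx0 x0y yb xy; have xy' := ltW xy.
  have d0 : 0 < y - x by rewrite subr_gt0.
  have : itg x y (fun=> u x0 ^+ 2) <=
      itg x y (fun t => 2 * u t ^+ 2 + 2 * (C * (y - x)) ^+ 2).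
    have ui := intg_sub ax' yb (intg_sqr bu).
    apply: le_itg; first exact: intg_cst.
      by apply: intgD; [exact: intgZ|exact: intg_cst].
    move=> t /andP[xt ty].
    have : (u x0 - u t) ^+ 2 <= (C * (y - x)) ^+ 2.
      have [x0t|tx0] := leP x0 t.
        rewrite -sqrrN opprB; apply: le_trans (Lip _ _ _ _ _) _ => //.
          exact: le_trans yb.
        by apply: sqm; [rewrite mulr_ge0 ?subr_ge0|apply: ler_wpM2l => //; lra].
      apply: le_trans (Lip _ _ _ _ _) _ => //; [exact: le_trans xt|exact: ltW|].
      apply: sqm; [rewrite mulr_ge0// subr_ge0; exact: ltW|].
      by apply: ler_wpM2l => //; lra.
    have := sqr_ge0 (u x0 - 2 * u t); nra.
  have ui := intg_sub ax' yb (intg_sqr bu).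
  rewrite itgD; [|exact: intgZ|exact: intg_cst].
  rewrite itgZ// !itg_cst// => H; have := sub0 _ _ ax' xy' yb => H0.
  rewrite -(ler_pM2r d0); lra.
apply/eqP; rewrite -sqrf_eq0 eq_le sqr_ge0 andbT leNgt; apply/negP => u0.
(* The first bound leaves room for an interval of length [d] on one side of [x0]; the
   second one makes [2 * (C * d) ^+ 2] smaller than [u x0 ^+ 2]. *)
pose d := Num.min ((b - a) / 2) (u x0 ^+ 2 / (4 * (C ^+ 2 * (b - a) + 1))).
have C2 : 0 <= C ^+ 2 * (b - a) by rewrite mulr_ge0// ?sqr_ge0// subr_ge0 ltW.
have D0 : 0 < 4 * (C ^+ 2 * (b - a) + 1) by lra.
have d0 : 0 < d by rewrite lt_min divr_gt0 ?subr_gt0//= divr_gt0.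
have d1 : d <= (b - a) / 2 by rewrite ge_min lexx.
have d2 : d <= u x0 ^+ 2 / (4 * (C ^+ 2 * (b - a) + 1)) by rewrite ge_min lexx orbT.
have d3 : u x0 ^+ 2 <= 2 * (C * d) ^+ 2.
  have [xdb|xdb] := leP (x0 + d) b.
    have := key x0 (x0 + d) ax (lexx _) _ xdb; rewrite addrAC subrr add0r.
    by apply; rewrite ?lerDl ?ltrDl// ltW.
  have := key (x0 - d) x0 _ _ (lexx _) xb; rewrite opprB addrCA subrr addr0.
  by apply; lra.
rewrite ler_pdivlMr// in d2.
have : C ^+ 2 * d * d <= C ^+ 2 * d * (b - a).
  by apply: ler_wpM2l; [rewrite mulr_ge0 ?sqr_ge0 ?ltW|lra].
lra.
Qed.

End energy.

(** * Negative squares of symmetric matrices *)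

Section forms.
Context {R : realType} {n : nat}.
Implicit Types (A B M : 'M[R]_n) (v w x y : 'rV[R]_n).

Definition qform A x y := (x *m A *m y^T) 0 0.
Definition negdef A m (U : 'M[R]_(m, n)) :=
  forall v, (v <= U)%MS -> v != 0 -> qform A v v < 0.
Definition symmx A := A^T = A.
Definition nullity A := \rank (kermx A).

Lemma qformE A x y : qform A x y = \sum_i \sum_j x 0 i * A i j * y 0 j.
Proof.
rewrite /qform mxE; under eq_bigr do rewrite mxE big_distrl/=.
rewrite exchange_big/=; apply: eq_bigr => i _; apply: eq_bigr => j _.
by rewrite mxE.
Qed.

Lemma qformDl A x1 x2 y : qform A (x1 + x2) y = qform A x1 y + qform A x2 y.
Proof. by rewrite /qform !mulmxDl [LHS]mxE. Qed.
Lemma qformDr A x y1 y2 : qform A x (y1 + y2) = qform A x y1 + qform A x y2.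
Proof. by rewrite /qform linearD/= mulmxDr [LHS]mxE. Qed.
Lemma qformZl A k x y : qform A (k *: x) y = k * qform A x y.
Proof. by rewrite /qform -!scalemxAl [LHS]mxE. Qed.
Lemma qformZr A k x y : qform A x (k *: y) = k * qform A x y.
Proof. by rewrite /qform linearZ/= -scalemxAr [LHS]mxE. Qed.
Lemma qformC A x y : symmx A -> qform A x y = qform A y x.
Proof.
move=> As; rewrite /qform.
have -> : y *m A *m x^T = (x *m A *m y^T)^T.
  by rewrite !trmx_mul trmxK As mulmxA.
by rewrite [RHS]mxE.
Qed.
Lemma qform0 A x : qform A x 0 = 0.
Proof. by rewrite /qform trmx0 mulmx0 mxE. Qed.
Lemma qformN A x y : qform (- A) x y = - qform A x y.
Proof. by rewrite /qform mulmxN mulNmx [LHS]mxE. Qed.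
Lemma qformBm A B x y : qform (A - B) x y = qform A x y - qform B x y.
Proof. by rewrite /qform mulmxBr mulmxBl !mxE. Qed.
Lemma qformDm A B x y : qform (A + B) x y = qform A x y + qform B x y.
Proof. by rewrite /qform mulmxDr mulmxDl !mxE. Qed.

Lemma qform_ker A v w : (v <= kermx A)%MS -> qform A v w = 0.
Proof. by move=> /sub_kermxP vA; rewrite /qform vA mul0mx mxE. Qed.

(** The number of negative squares of the quadratic form of [A]. *)
Definition neg_index A :=
  \max_(k < n.+1 | `[< exists U : 'M[R]_n, negdef A U /\ \rank U = k >]) k.

Lemma neg_index_ex A : exists U : 'M[R]_n, negdef A U /\ \rank U = neg_index A.
Proof.
rewrite /neg_index; have [|k /asboolP Hk ->] := @eq_bigmax_cond _
   (fun k : 'I_n.+1 => `[< exists U : 'M[R]_n, negdef A U /\ \rank U = k >]) (fun k => k : nat).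
  apply/card_gt0P; exists ord0; apply/asboolP; exists 0; split; last by rewrite mxrank0.
  by move=> v; rewrite submx0 => /eqP ->; rewrite eqxx.
exact: Hk.
Qed.

Lemma neg_index_ge A m (U : 'M[R]_(m, n)) : negdef A U -> (\rank U <= neg_index A)%N.
Proof.
move=> UA; have kn : (\rank U < n.+1)%N by rewrite ltnS rank_leq_col.
rewrite /neg_index; apply: (@leq_bigmax_cond _ _ (fun k : 'I_n.+1 => k : nat) (Ordinal kn)).
apply/asboolP; exists <<U>>%MS; split; last by rewrite genmxE.
by move=> v; rewrite genmxE; exact: UA.
Qed.

Lemma negdef_ker A m (U : 'M[R]_(m, n)) : negdef A U -> (U :&: kermx A)%MS = 0.
Proof.
move=> UA; apply/eqP/rowV0P => v; rewrite sub_capmx => /andP[vU vA].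
apply/eqP/negP => /negP v0; have := UA v vU v0.
by rewrite qform_ker// ltxx.
Qed.

(** The form of [A] is nonpositive on the sum of a maximal negative subspace and the
    kernel, so a strictly smaller form is negative there. *)
Lemma neg_index_jump A B : symmx A -> (forall v, v != 0 -> qform B v v < qform A v v) ->
  (neg_index A + nullity A <= neg_index B)%N.
Proof.
move=> As AB; have [U [UA <-]] := neg_index_ex A.
rewrite /nullity -mxrank_disjoint_sum; last exact: negdef_ker.
apply: neg_index_ge => v /sub_addsmxP[[d e] /= ->] v0.
apply: lt_le_trans (AB _ v0) _.
set u := d *m U; set z := e *m kermx A.
have zA : (z <= kermx A)%MS by exact: submxMl.
rewrite qformDl !qformDr (qform_ker _ zA) (qform_ker _ zA) (qformC _ _ As) (qform_ker _ zA).
rewrite !addr0; have [->|u0] := eqVneq u 0; first by rewrite qform0.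
by apply/ltW/UA => //; exact: submxMl.
Qed.

(** Let [U] be a maximal negative subspace. The form is nonnegative on its
    orthogonal [C], as a negative vector of [C] would enlarge [U]. A vector of [C]
    on which the form vanishes is orthogonal to [C] by the argument of Cauchy and
    Schwarz, and to [U], so it is in the kernel. Hence the form is positive on a
    complement of the kernel in [C]. *)
Lemma posdef_ex A : symmx A -> exists P : 'M[R]_n, negdef (- A) P /\
  (n <= \rank P + (neg_index A + nullity A))%N.
Proof.
move=> As; have [U [UA UE]] := neg_index_ex A.
pose C := kermx (A *m U^T).
have Crank : (n <= \rank C + neg_index A)%N.
  rewrite mxrank_ker -UE.
  have := mxrankM_maxr A U^T; rewrite mxrank_tr => H.
  by rewrite -leq_subLR subKn ?rank_leq_row //; lia.
have CU v u : (v <= C)%MS -> (u <= U)%MS -> qform A v u = 0.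
  move=> /sub_kermxP vC /submxP[d ->].
  by rewrite /qform trmx_mul mulmxA -(mulmxA v) vC mul0mx mxE.
have Cge v : (v <= C)%MS -> 0 <= qform A v v.
  move=> vC; rewrite leNgt; apply/negP => v0.
  have vU : ~~ (v <= U)%MS.
    by apply/negP => vU; rewrite CU// ltxx in v0.
  have UvA : negdef A (U + v)%MS.
    move=> w /sub_addsmxP[[d e] /= ->] w0.
    have [k ek] : exists k, e *m v = k *: v.
      by exists (e 0 0); rewrite [e]mx11_scalar mul_scalar_mx !mxE eqxx mulr1n.
    rewrite ek in w0 *; set u := d *m U in w0 *.
    have uU : (u <= U)%MS by exact: submxMl.
    rewrite qformDl !qformDr !qformZl !qformZr (qformC u v As) (CU v u)// !mulr0 addr0 add0r.
    have [u0|u0] := eqVneq u 0.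
      rewrite u0 qform0 add0r mulrA; rewrite u0 add0r scaler_eq0 in w0.
      rewrite -expr2 pmulr_rlt0// lt_neqAle sqr_ge0 andbT eq_sym sqrf_eq0.
      by case/norP: w0.
    apply: ltr_wnDr; last exact: UA.
    by rewrite mulrA -expr2 mulr_ge0_le0 ?sqr_ge0// ltW.
  have := neg_index_ge UvA; rewrite -UE leqNgt => /negP; apply.
  rewrite (ltn_leqif (mxrank_leqif_sup (addsmxSl U v))).
  by apply: contra vU => /(submx_trans (addsmxSr U v)).
have UC0 : (U :&: C)%MS = 0.
  apply/eqP/rowV0P => v; rewrite sub_capmx => /andP[vU vC].
  apply/eqP/negP => /negP v0; have := UA v vU v0.
  by rewrite CU// ltxx.
have UCfull v : (v <= U + C)%MS.
  apply: submx_full; rewrite /row_full eqn_leq rank_leq_col/=.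
  by rewrite mxrank_disjoint_sum// UE addnC.
exists (C :\: kermx A)%MS; split; last first.
  have := mxrank_cap_compl C (kermx A).
  have : (\rank (C :&: kermx A) <= nullity A)%N by rewrite mxrankS// capmxSr.
  by lia.
move=> v vP v0; rewrite qformN oppr_lt0.
have vC : (v <= C)%MS by exact: submx_trans vP (diffmxSl _ _).
rewrite lt_neqAle Cge// andbT eq_sym; apply/eqP => vv0.
have vw w : (w <= C)%MS -> qform A v w = 0.
  move=> wC.
  have H t : 0 <= 2 * t * qform A v w + t ^+ 2 * qform A w w.
    have : 0 <= qform A (v + t *: w) (v + t *: w).
      by apply: Cge; rewrite addmx_sub// scalemx_sub.
    rewrite qformDl !qformDr !qformZl !qformZr vv0 (qformC w v As); lra.
  have W0 := Cge w wC.
  apply/eqP/negP => /negP ne.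
  set p := qform A v w in ne H; set r := qform A w w in H W0.
  have p2 : 0 < p ^+ 2 by rewrite lt_neqAle sqr_ge0 andbT eq_sym sqrf_eq0.
  (* The parabola [H] is negative here; [r + 1] replaces [r], which may be zero. *)
  have := H (- p / (r + 1)).
  have r1 : r + 1 != 0 by rewrite gt_eqF//; lra.
  have -> : 2 * (- p / (r + 1)) * p + (- p / (r + 1)) ^+ 2 * r =
    - (p ^+ 2 * ((r + 2) / (r + 1) ^+ 2)) by field.
  rewrite oppr_ge0 leNgt => /negP; apply; rewrite mulr_gt0// divr_gt0//; first lra.
  by rewrite exprn_gt0//; lra.
have vK : (v <= kermx A)%MS.
  apply/sub_kermxP/rowP => i; rewrite [RHS]mxE.
  have -> : (v *m A) 0 i = qform A v (delta_mx 0 i).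
    by rewrite /qform trmx_delta -colE [RHS]mxE.
  have /sub_addsmxP[[d e] /= ->] := UCfull (delta_mx 0 i).
  by rewrite qformDr CU ?submxMl// vw ?submxMl// addr0.
have : (v <= (C :\: kermx A) :&: kermx A)%MS by rewrite sub_capmx vP vK.
by rewrite capmx_diff submx0 (negPf v0).
Qed.

End forms.

(** * Decreasing families of symmetric matrices *)

Section openness.
Context {R : realType} {n : nat}.
Implicit Types (A B : 'M[R]_n) (v w x y : 'rV[R]_n).

Lemma continuous_sumR (T : topologicalType) (I : Type) (r : seq I)
    (F : I -> T -> R) : (forall i, continuous (F i)) ->
  continuous (fun z : T => \sum_(i <- r) F i z).
Proof.
move=> Fc z; elim: r => [|i r IH].
  by under eq_fun do rewrite big_nil; exact: cvg_cst.
under eq_fun do rewrite big_cons.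
by apply: cvgD => //; exact: Fc.
Qed.

Let nsq v := \sum_i v 0 i ^+ 2.

Let coordc (i : 'I_n) : continuous (fun v : 'rV[R]_n => v 0 i).
Proof. exact: coord_continuous. Qed.

Let nsqc : continuous nsq.
Proof. by apply: continuous_sumR => i x; exact: (cvgM (@coordc i x) (@coordc i x)). Qed.

Let nsq_ge0 v : 0 <= nsq v.
Proof. by apply: sumr_ge0 => i _; exact: sqr_ge0. Qed.

Let nsq_gt0 v : v != 0 -> 0 < nsq v.
Proof.
move=> v0; rewrite lt_neqAle nsq_ge0 andbT eq_sym; apply: contra v0.
rewrite psumr_eq0 => [/allP v0|i _]; last exact: sqr_ge0.
apply/eqP/rowP => i; have := v0 i (mem_index_enum _); rewrite sqrf_eq0 mxE.
by move=> /eqP.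
Qed.

(** By compactness of the Euclidean unit sphere of [U], the form is at most
    [- d |v| ^ 2] on [U], and this survives a small change of the entries. *)
Lemma negdef_open A m (U : 'M[R]_(m, n)) : negdef A U ->
  exists2 e : R, 0 < e &
    forall B, (forall i j, `|B i j - A i j| <= e) -> negdef B U.
Proof.
move=> UA.
pose C := cokermx U.
pose Z v := \sum_j (\sum_k v 0 k * C k j) ^+ 2.
have Zc : continuous Z.
  apply: continuous_sumR => j; have Hc : continuous (fun v => \sum_k v 0 k * C k j).
    by apply: continuous_sumR => k x; exact: (cvgM (@coordc k x) (cvg_cst _)).
  by move=> x; exact: (cvgM (Hc x) (Hc x)).
have ZP v : Z v = 0 <-> (v <= U)%MS.
  rewrite submxE; split => [/eqP|/eqP vC].
    rewrite psumr_eq0 => [/allP z0|i _]; last exact: sqr_ge0.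
    apply/eqP/rowP => j; have := z0 j (mem_index_enum _).
    by rewrite sqrf_eq0 => /eqP; rewrite !mxE.
  rewrite /Z big1// => j _; have := congr1 (fun z : 'rV_n => z 0 j) vC.
  by rewrite !mxE => ->; rewrite expr0n.
pose box := [set v : 'rV[R]_n | forall i, `[(-1 : R), 1]%classic (v 0 i)].
(* The unit sphere of [U]: the box makes it compact, and [Z] vanishes exactly on [U]. *)
pose S := (box `&` [set v | nsq v = 1]) `&` [set v | Z v = 0].
have cS : compact S.
  apply: compact_closedI; last first.
    by apply: (closed_comp (f := Z) (D := [set 0])) => // *; exact: Zc.
  apply: compact_closedI; last first.
    by apply: (closed_comp (f := nsq) (D := [set 1])) => // *; exact: nsqc.
  by apply: (@rV_compact R n (fun=> `[(-1 : R), 1]%classic)) => i; exact: segment_compact.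
have fc : continuous (fun v => qform A v v).
  have -> : (fun v => qform A v v) = (fun v => \sum_i \sum_j v 0 i * A i j * v 0 j).
    by apply/funext => v; rewrite qformE.
  apply: continuous_sumR => i; apply: continuous_sumR => j x.
  exact: (cvgM (cvgM (@coordc i x) (cvg_cst _)) (@coordc j x)).
have [d d0 Hd] : exists2 d : R, 0 < d & forall v, S v -> qform A v v <= - d.
  have [S0|/set0P/negP/negPn/eqP S0] := pselect (S !=set0); last first.
    by exists 1 => // v; rewrite S0.
  have [c cSS cM] := compact_EVT_max S0 cS (continuous_subspaceT fc).
  exists (- qform A c c); last by move=> v Sv; rewrite opprK; apply: cM; rewrite inE.
  rewrite oppr_gt0; apply: UA.
    by apply/ZP; move: cSS; rewrite inE => -[].
  apply/eqP => c0; move: cSS; rewrite inE => -[[_ /=]].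
  rewrite c0 /nsq big1 => [/eqP|i _]; first by rewrite eq_sym oner_eq0.
  by rewrite mxE expr0n.
have hom v : (v <= U)%MS -> qform A v v <= - d * nsq v.
  move=> vU; have [->|v0] := eqVneq v 0.
    by rewrite qform0 /nsq big1 ?mulr0// => i _; rewrite mxE expr0n.
  have N0 := nsq_gt0 v0.
  pose s := Num.sqrt (nsq v); have s0 : 0 < s by rewrite sqrtr_gt0.
  have s2 : s ^+ 2 = nsq v by rewrite sqr_sqrtr// ltW.
  have nw : nsq (s^-1 *: v) = 1.
    rewrite /nsq; under eq_bigr do rewrite mxE exprMn.
    rewrite -big_distrr/= -/(nsq v) -s2 exprVn mulVf// expf_neq0// gt_eqF//.
  have /Hd : S (s^-1 *: v).
    split; last by apply/ZP; rewrite scalemx_sub.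
    split => // i; rewrite /= in_itv/= -ler_norml.
    have : (s^-1 *: v) 0 i ^+ 2 <= 1.
      rewrite -nw /nsq (bigD1 i)//= lerDl sumr_ge0// => j _; exact: sqr_ge0.
    by rewrite -[leLHS]real_normK ?num_real// expr_le1.
  rewrite qformZl qformZr => H.
  have : s ^+ 2 * (s^-1 * (s^-1 * qform A v v)) <= s ^+ 2 * - d.
    by apply: ler_wpM2l => //; exact: sqr_ge0.
  rewrite s2 [leLHS](_ : _ = qform A v v); first by rewrite mulrC.
  by rewrite -s2; field; rewrite gt_eqF.
exists (d / (2 * (n%:R + 1))).
  by rewrite divr_gt0// mulr_gt0// ltr_wpDl// ler0n.
set e := d / _ => B HB v vU v0.
have e0 : 0 <= e by rewrite /e divr_ge0 ?mulr_ge0 ?addr_ge0 ?ler0n// ltW.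
have : qform (B - A) v v <= e * (n%:R * nsq v).
  rewrite qformE; apply: (@le_trans _ _ (\sum_i \sum_j e * ((v 0 i ^+ 2 + v 0 j ^+ 2) / 2))).
    apply: ler_sum => i _; apply: ler_sum => j _.
    apply: le_trans (ler_norm _) _; rewrite !normrM mulrAC.
    rewrite mulrC; apply: ler_pM => //; first by rewrite !mxE; exact: HB.
    rewrite -[v 0 i ^+ 2]real_normK ?num_real// -[v 0 j ^+ 2]real_normK ?num_real//.
    have := sqr_ge0 (`|v 0 i| - `|v 0 j|); nra.
  rewrite le_eqVlt; apply/predU1P; left.
  under eq_bigr do rewrite -big_distrr/= -mulr_suml big_split/=.
  rewrite -big_distrr/= -mulr_suml big_split/=; congr (_ * _).
  rewrite sumr_const -/(nsq v).
  under eq_bigr do rewrite sumr_const.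
  by rewrite sumrMnl card_ord -/(nsq v) -[_ *+ n]mulr_natl; field.
rewrite qformBm.
have : e * (n%:R * nsq v) <= d / 2 * nsq v.
  rewrite mulrA ler_wpM2r// /e.
  rewrite mulrAC ler_pdivrMr; last by rewrite mulr_gt0// ltr_wpDl// ler0n.
  have n0 : 0 <= n%:R :> R by exact: ler0n.
  have : 0 < d by []. nra.
have := hom v vU; have := nsq_gt0 v0 => N0.
have : 0 < d * nsq v by rewrite mulr_gt0.
lra.
Qed.

End openness.

Section counting.
Context {R : realType} {n : nat}.
Variables (M : R -> 'M[R]_n) (a : R).
Hypotheses (a0 : a < 0)
  (Msym : forall t, a <= t <= 0 -> symmx (M t))
  (Mdecr : forall s t, a <= s -> s < t -> t <= 0 ->
     forall v, v != 0 -> qform (M t) v v < qform (M s) v v)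
  (Mcont : forall t, a <= t <= 0 -> forall e : R, 0 < e ->
     exists2 d : R, 0 < d & forall s, a <= s <= 0 -> `|s - t| < d ->
       forall i j, `|M s i j - M t i j| <= e)
  (Mpos : forall v, v != 0 -> 0 < qform (M a) v v).

Let nu t := neg_index (M t).
Let k t : nat := nullity (M t).

Let nu_jump s t : a <= s -> s < t -> t <= 0 -> (nu s + k s <= nu t)%N.
Proof.
move=> as_ st t0; apply: neg_index_jump; last exact: Mdecr.
by apply: Msym; rewrite as_ (le_trans _ t0)// ltW.
Qed.

Let nu_a : nu a = 0%N /\ k a = 0%N.
Proof.
split.
  rewrite /nu; have [U [UA <-]] := neg_index_ex (M a).
  apply/eqP; rewrite mxrank_eq0; apply/rowV0P => v vU.
  apply/eqP/negP => /negP v0; have := UA v vU v0; have := Mpos v0; lra.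
apply/eqP; rewrite /k /nullity mxrank_eq0; apply/rowV0P => v vK.
apply/eqP/negP => /negP v0; have := Mpos v0; by rewrite qform_ker// ltxx.
Qed.

Let nu_near t : a <= t <= 0 -> exists2 d : R, 0 < d &
  forall s, a <= s <= 0 -> `|s - t| < d ->
   (nu t <= nu s)%N /\ (nu s <= nu t + k t)%N.
Proof.
move=> ta; have [U [UA UE]] := neg_index_ex (M t).
have [P [PA PE]] := posdef_ex (Msym ta).
have [e1 e10 He1] := negdef_open UA.
have [e2 e20 He2] := negdef_open PA.
have [d1 d10 Hd1] := Mcont ta e10.
have [d2 d20 Hd2] := Mcont ta e20.
exists (Num.min d1 d2); first by rewrite lt_min d10.
move=> s sa; rewrite lt_min => /andP[sd1 sd2]; split.
  by rewrite /nu -UE; apply/neg_index_ge/He1; exact: Hd1.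
have PB : negdef (- M s) P.
  apply: He2 => i j; rewrite !mxE -opprD normrN; exact: Hd2.
rewrite /nu; have [W [WA <-]] := neg_index_ex (M s).
have WP : (W :&: P)%MS = 0.
  apply/eqP/rowV0P => v; rewrite sub_capmx => /andP[vW vP].
  apply/eqP/negP => /negP v0; have := WA v vW v0; have := PB v vP v0.
  rewrite qformN; lra.
rewrite -(leq_add2r (\rank P)) -mxrank_disjoint_sum// addnC.
exact: leq_trans (rank_leq_col _) PE.
Qed.

(* The [j]-th unit of the negative index is gained at the infimum [t] of the points
   where the index exceeds [j]: the index at [t] is at most [j], since otherwise
   it would exceed [j] slightly before [t], and it exceeds [j] at points arbitrarily
   close to [t]. *)
Let crossing (j : nat) : (j < nu 0)%N ->
  exists t, [/\ a < t, t < 0, (nu t <= j)%N & (j < nu t + k t)%N].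
Proof.
move=> j0; pose E := [set t | a <= t <= 0 /\ (j < nu t)%N].
have E0 : E 0 by split => //; rewrite lexx ltW.
have hE : has_inf E by split; [exists 0|exists a => x [/andP[]]].
pose t := inf E.
have ta : a <= t by apply: lb_le_inf => [|x [/andP[]]]; [exists 0|].
have t0 : t <= 0 by apply: ge_inf => //; case: hE.
have [nua ka] := nu_a.
have [|d d0 Hd] := @nu_near t; first by rewrite ta.
have nut : (nu t <= j)%N.
  rewrite leqNgt; apply/negP => jt.
  have ta' : a < t.
    rewrite lt_neqAle ta andbT; apply/eqP => at_.
    by move: jt; rewrite -at_ nua.
  pose s := Num.max a (t - d / 2).
  have st : s < t by rewrite gt_max ta'/=; lra.
  have sa : a <= s by rewrite le_max lexx.
  have sE : E s.
    split; first by rewrite sa (le_trans (ltW st)).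
    have [|//|H _] := Hd s; first by rewrite sa (le_trans (ltW st)).
      have : t - d / 2 <= s by rewrite le_max lexx orbT.
      by rewrite ltr_norml; lra.
    exact: leq_trans H.
  have : t <= s by apply: ge_inf => //; case: hE.
  lra.
have jt : (j < nu t + k t)%N.
  have [s [sa js] std] := inf_adherent d0 hE.
  have ts : t <= s by apply: ge_inf => //; case: hE.
  have [//||_ H] := Hd s; last exact: leq_trans H.
  by rewrite ltr_norml; lra.
exists t; split => //.
  by rewrite lt_neqAle ta andbT; apply/eqP => at_; move: jt; rewrite -at_ nua ka.
rewrite lt_neqAle t0 andbT; apply/eqP => t00; move: nut.
by rewrite t00 leqNgt j0.
Qed.

(** The sum is at most the index because the index grows by at least the nullity
    past every point. It is at least the index because each unit [j] of the index
    is gained at some [t], and at most [nullity (M t)] units are gained at [t]. *)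
Lemma sum_nullity : \esum_(t in [set t | a < t < 0]) (nullity (M t))%:R%:E =
  (neg_index (M 0))%:R%:E :> \bar R.
Proof.
apply/eqP; rewrite eq_le; apply/andP; split.
  apply: ge_ereal_sup => _ [X [Xf XS] <-].
  have up (s : seq R) b : sorted <%R s -> all (fun t => a < t < b) s -> a <= b -> b <= 0 ->
      (\sum_(t <- s) k t <= nu b)%N.
    elim/last_ind: s b => [|s t IH] b; first by rewrite big_nil.
    rewrite -cats1 big_cat/= big_seq1 all_cat/= andbT cats1 => srt /andP[sab /andP[at_ tb]] ab b0.
    apply: leq_trans (nu_jump (ltW at_) tb b0); rewrite leq_add2r; apply: IH => //.
    - by move: srt; rewrite -cats1 => /cat_sorted2[].
    - apply/allP => x xs; move/allP: sab => /(_ x xs) /andP[-> _] /=.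
      move: srt; rewrite sorted_pairwise; last exact: lt_trans.
      by rewrite pairwise_rcons => /andP[/allP/(_ x xs)].
    - exact: ltW.
    - by rewrite (le_trans _ b0)// ltW.
  pose s := sort <=%R (finmap.enum_fset (fset_set X)).
  rewrite fsbig_finite//= (perm_big s)/=; last by rewrite perm_sym perm_sort.
  rewrite sumEFin lee_fin -natr_sum ler_nat; apply: up => //; last exact: ltW.
    rewrite sort_lt_sorted; exact: finmap.fset_uniq.
  apply/allP => x; rewrite mem_sort in_fset_set// inE => /XS //.
have tj (j : 'I_(nu 0)) := cid (crossing (ltn_ord j)).
pose t j := sval (tj j).
pose s := undup [seq t j | j <- enum 'I_(nu 0)].
have us : uniq s by exact: undup_uniq.
have sP x : x \in s -> exists j, x = t j.
  by rewrite mem_undup => /mapP[j _ ->]; exists j.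
apply: le_trans (_ : (\sum_(x <- s) k x)%:R%:E <= _)%E.
  rewrite lee_fin ler_nat -[leqLHS]/(nu 0) -[leqLHS]card_ord -sum1_card.
  have -> : (\sum_(j in 'I_(nu 0)) 1 = \sum_(x <- s) \sum_(j : 'I_(nu 0) | t j == x) 1)%N.
    rewrite (exchange_big_dep xpredT)//=; apply: eq_bigr => j _.
    rewrite (big_rem (t j))/=; last first.
      by rewrite mem_undup map_f// mem_enum.
    rewrite eqxx big_seq_cond big_pred0 ?addn0// => x.
    rewrite mem_rem_uniq// inE/=; by case: eqVneq => [->|]; rewrite ?eqxx ?andbF.
  apply: leq_sum => x _; rewrite sum1_card.
  rewrite cardE -(size_map val).
  have -> : k x = size (iota (nu x) (k x)) by rewrite size_iota.
  apply: uniq_leq_size; first by rewrite (map_inj_uniq val_inj) enum_uniq.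
  move=> _ /mapP[j + ->]; rewrite mem_enum unfold_in => /eqP <-.
  by rewrite mem_iota; have [_ _ -> ->] := svalP (tj j).
apply: esum_ge; exists [set` s].
  split; first exact: finite_seq.
  move=> x /= /sP[j ->]; have [-> -> _ _] := svalP (tj j); done.
by rewrite -fsbig_seq// sumEFin -natr_sum.
Qed.
End counting.

(** * The Dirichlet-to-Neumann matrix of a network of pieces *)

Section sol_linear.
Context {R : realType}.
Variables (Q : R -> R) (a b : R).
Hypotheses (ab : a < b) (Qi : intg a b Q).

Lemma solD u u1 v v1 : sol Q a b u u1 -> sol Q a b v v1 ->
  sol Q a b (fun x => u x + v x) (fun x => u1 x + v1 x).
Proof.
move=> [bu bu1 uE u1E] [bv bv1 vE v1E]; split; try exact: bmfD.
  by apply: primD => //; exact: intg_bmf.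
move=> x xab; have := primD (intgM Qi bu) (intgM Qi bv) u1E v1E xab.
by move=> ->; congr (_ + _); apply: eq_itg => t _; rewrite mulrDr.
Qed.

Lemma solZ k u u1 : sol Q a b u u1 ->
  sol Q a b (fun x => k * u x) (fun x => k * u1 x).
Proof.
move=> [bu bu1 uE u1E]; split; try exact: bmfZ.
  by apply: primZ => //; exact: intg_bmf.
move=> x xab; have := primZ k (intgM Qi bu) u1E xab.
by move=> ->; congr (_ + _); apply: eq_itg => t _; rewrite mulrCA.
Qed.

Lemma sol0_deriv u u1 : sol Q a b u u1 -> (forall x, a <= x <= b -> u x = 0) ->
  u1 a = 0 /\ u1 b = 0.
Proof.
move=> [bu bu1 uE u1E] u0.
have u1c x : a <= x <= b -> u1 x = u1 a.
  move=> /andP[ax xb]; rewrite u1E ?ax// (@eq_itg _ _ _ _ (fun=> 0)).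
    by rewrite itg_cst// mul0r addr0.
  by move=> t /andP[at_ tx]; rewrite u0 ?mulr0// at_ (le_trans tx).
have bab : a <= b <= b by rewrite lexx ltW.
have aab : a <= a <= b by rewrite lexx ltW.
have := uE b bab; rewrite !u0// add0r (@eq_itg _ _ _ _ (fun=> u1 a)); last exact: u1c.
rewrite itg_cst ?ltW// => /esym/eqP; rewrite mulf_eq0 subr_eq0 (gt_eqF ab) orbF.
by move=> /eqP u1a; rewrite (u1c b)// u1a.
Qed.

End sol_linear.

Section dtn.
Context {R : realType} (P Nd : finType).
Variables (en : P -> bool -> Nd) (al be : P -> R) (q : P -> R -> R) (h K : R).
Hypotheses (h0 : 0 < h) (K0 : 0 < K) (hK : h * K <= 20^-1)
  (beE : forall p, be p = al p + h)
  (qi : forall p, intg (al p) (be p) (q p))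
  (qK : forall p, itg (al p) (be p) (fun t => `|q p t|) <= K).

Local Notation n := #|Nd|.
(** The hypothesis [h * K <= 1/20] serves two purposes with this value: at
    [lam <= - lam0] the term [- lam int u ^ 2] dominates the potential on every
    piece, while for [- lam0 <= lam <= 0] the potential [q - lam] still has an
    integral small enough for boundary value problems to be well posed. *)
Definition lam0 := 4 * K / h.
Definition pt p (s : bool) := if s then be p else al p.
(** The derivative at an end of a piece in the direction pointing out of it. *)
Definition flux p (s : bool) (u1 : R -> R) := (if s then 1 else -1) * u1 (pt p s).
Definition nval (F : Type) (c : 'rV[F]_n) v := c 0 (enum_rank v).
Definition piece_sol p lam := sol (fun t => q p t - lam) (al p) (be p).

Lemma al_be p : al p < be p. Proof. by rewrite beE ltrDl. Qed.

Lemma lam0_gt0 : 0 < lam0.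
Proof. by rewrite divr_gt0// mulr_gt0. Qed.

Lemma ql_intg p lam : intg (al p) (be p) (fun t => q p t - lam).
Proof. by apply: intgB => //; exact: intg_cst. Qed.

Lemma piece_small p lam : - lam0 <= lam <= 0 ->
  (be p - al p) * itg (al p) (be p) (fun t => `|q p t - lam|) <= 4^-1.
Proof.
move=> /andP[l0 l1]; have ab := al_be p.
have hE : be p - al p = h by rewrite beE; ring.
rewrite hE.
have : itg (al p) (be p) (fun t => `|q p t - lam|) <= K + lam0 * h.
  apply: (@le_trans _ _ (itg (al p) (be p) (fun t => `|q p t| + `|lam|))).
    apply: le_itg.
    - exact/intg_norm/ql_intg.
    - by apply: intgD; [exact: intg_norm|exact: intg_cst].
    - by move=> x _; exact: ler_normB.
  rewrite itgD; [|exact: intg_norm|exact: intg_cst].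
  rewrite itg_cst; last exact: ltW.
  rewrite hE; apply: lerD => //; apply: ler_wpM2r; first exact: ltW.
  by rewrite ler0_norm//; lra.
move=> /(ler_wpM2l (ltW h0)) /le_trans; apply.
have -> : lam0 * h = 4 * K by rewrite /lam0; field; have := h0; lra.
have := hK; lra.
Qed.

Lemma pt_in p s : al p <= pt p s <= be p.
Proof. by case: s; rewrite /pt lexx ltW// al_be. Qed.

Lemma flux_lowP p lam u u1 : piece_sol p lam u u1 -> lam <= - lam0 ->
  2 * K * itg (al p) (be p) (fun t => u t ^+ 2) <=
  h * (u1 (be p) * u (be p) - u1 (al p) * u (al p)).
Proof.
move=> us lamP; have hE : be p - al p = h by rewrite beE; ring.
have hk := hK; have hp := h0.
rewrite -{1}hE; apply: (flux_low (al_be p) (qi p)) us => //; rewrite hE; first lra.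
rewrite [leLHS](_ : _ = h * lam0); last by rewrite /lam0; field; lra.
by apply: ler_wpM2l; lra.
Qed.

Lemma flux_ge0 p lam u u1 : piece_sol p lam u u1 -> lam <= - lam0 ->
  0 <= u1 (be p) * u (be p) - u1 (al p) * u (al p).
Proof.
move=> us lamP; rewrite -(pmulr_rge0 _ h0); apply: le_trans (flux_lowP us lamP).
apply: mulr_ge0; first by rewrite mulr_ge0// ltW.
by apply: itg_ge0 => x _; exact: sqr_ge0.
Qed.

Lemma flux_eq0 p lam u u1 : piece_sol p lam u u1 -> lam <= - lam0 ->
  u1 (be p) * u (be p) - u1 (al p) * u (al p) <= 0 ->
  forall x, al p <= x <= be p -> u x = 0.
Proof.
move=> us lamP F0; have [_ bu1 uE _] := us.
apply: itg_sqr_eq0 (al_be p) uE bu1 _.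
have K2 : 0 < 2 * K by rewrite mulr_gt0.
rewrite -(pmulr_rle0 _ K2); apply: le_trans (flux_lowP us lamP) _.
by rewrite pmulr_rle0.
Qed.

Lemma piece_sol_exists p lam A B : - lam0 <= lam <= 0 ->
  exists u : (R -> R) * (R -> R),
    [/\ piece_sol p lam u.1 u.2, u.1 (al p) = A & u.1 (be p) = B].
Proof.
move=> lamP; have [u [u1 [su ua ub]]] :=
  sol_exists (al_be p) (@ql_intg p lam) (piece_small p lamP) A B.
by exists (u, u1).
Qed.

Lemma piece_sol_unique p lam u u1 : - lam0 <= lam <= 0 ->
  piece_sol p lam u u1 -> u (al p) = 0 -> u (be p) = 0 ->
  (forall x, al p <= x <= be p -> u x = 0) /\ forall s, u1 (pt p s) = 0.
Proof.
move=> lamP su ua ub.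
have u0 x : al p <= x <= be p -> u x = 0.
  move=> xab.
  have := sol_bound (al_be p) (@ql_intg p lam) (piece_small p lamP) su xab.
  by rewrite ua ub normr0 addr0 mulr0 normr_le0 => /eqP.
by split=> //; have [u1a u1b] := sol0_deriv (al_be p) su u0; case.
Qed.

(** Subtract from a solution the combination of the two fundamental solutions, with
    boundary values (1, 0) and (0, 1), that has the same boundary values; the rest
    is zero by uniqueness. *)
Lemma piece_dtn (pl : P * R) : exists k : bool -> bool -> R,
  - lam0 <= pl.2 <= 0 -> forall u u1, piece_sol pl.1 pl.2 u u1 ->
  forall s, flux pl.1 s u1 = \sum_(s' : bool) u (pt pl.1 s') * k s' s.
Proof.
case: pl => p lam /=.
have [lamP|_] := boolP (- lam0 <= lam <= 0); last by exists (fun _ _ => 0).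
have [f [fs fa fb]] := piece_sol_exists p 1 0 lamP.
have [g [gs ga gb]] := piece_sol_exists p 0 1 lamP.
exists (fun s' s => flux p s (if s' then g.2 else f.2)) => _ u u1 us s.
have Qi := @ql_intg p lam.
have ws := solD Qi us (solD Qi (solZ Qi (- u (al p)) fs) (solZ Qi (- u (be p)) gs)).
have [||_ w1] := piece_sol_unique lamP ws.
- by rewrite fa ga; ring.
- by rewrite fb gb; ring.
rewrite big_bool /flux/=; have := w1 s => w1s.
have -> : u1 (pt p s) = u (al p) * f.2 (pt p s) + u (be p) * g.2 (pt p s) by lra.
by ring.
Qed.

(** This balance of fluxes at the nodes characterizes [M lam], because solutions
    exist for all node values; symmetry, monotonicity, positivity and continuity
    are derived from it. *)
Lemma dtn_exists : exists M : R -> 'M[R]_n, forall lam, - lam0 <= lam <= 0 ->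
  forall (c : 'rV_n) (u u1 : P -> R -> R),
    (forall p, piece_sol p lam (u p) (u1 p)) ->
    (forall p s, u p (pt p s) = nval c (en p s)) ->
  forall v, nval (c *m M lam) v =
    \sum_p \sum_(s : bool | en p s == v) flux p s (u1 p).
Proof.
have [k kE] := choice piece_dtn.
exists (fun lam => \sum_p \sum_(s : bool) \sum_(s' : bool)
   k (p, lam) s' s *: delta_mx (enum_rank (en p s')) (enum_rank (en p s))).
move=> lam lamP c u u1 us uc v.
rewrite /nval mulmx_sumr summxE; apply: eq_bigr => p _.
rewrite mulmx_sumr summxE [RHS]big_mkcond/=; apply: eq_bigr => s _.
rewrite mulmx_sumr summxE (kE (p, lam) lamP _ _ (us p)) /=.
case: eqVneq => [<-|ne].
  apply: eq_bigr => s' _; rewrite -scalemxAr mxE uc mulrC; congr (_ * _).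
  rewrite mxE (bigD1 (enum_rank (en p s')))//= mxE !eqxx mulr1 big1 ?addr0//.
  by move=> i ine; rewrite mxE (negPf ine) mulr0.
rewrite big1// => s' _; rewrite -scalemxAr mxE mxE big1 ?mulr0// => i _.
rewrite mxE [enum_rank v == _]eq_sym (inj_eq enum_rank_inj) (negPf ne) andbF mulr0//.
Qed.

Section matrix.
Variable M : R -> 'M[R]_n.
Hypothesis ME : forall lam, - lam0 <= lam <= 0 ->
  forall (c : 'rV_n) (u u1 : P -> R -> R),
    (forall p, piece_sol p lam (u p) (u1 p)) ->
    (forall p s, u p (pt p s) = nval c (en p s)) ->
  forall v, nval (c *m M lam) v =
    \sum_p \sum_(s : bool | en p s == v) flux p s (u1 p).
Hypothesis touch : forall v, exists p s, en p s = v.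

Lemma family_exists lam (c : 'rV[R]_n) : - lam0 <= lam <= 0 ->
  exists u : P -> (R -> R) * (R -> R),
    (forall p, piece_sol p lam (u p).1 (u p).2) /\
    (forall p s, (u p).1 (pt p s) = nval c (en p s)).
Proof.
move=> lamP.
have [u uE] := choice (fun p => piece_sol_exists p (nval c (en p false)) (nval c (en p true)) lamP).
by exists u; split=> [p|p []]; have [] := uE p.
Qed.

Lemma sum_nodes (F : P -> bool -> R) (d : Nd -> R) :
  \sum_v (\sum_p \sum_(s : bool | en p s == v) F p s) * d v =
  \sum_p \sum_(s : bool) F p s * d (en p s).
Proof.
under eq_bigr do rewrite mulr_suml.
rewrite exchange_big/=; apply: eq_bigr => p _.
under eq_bigr do rewrite mulr_suml big_mkcond/=.
rewrite exchange_big/=; apply: eq_bigr => s _.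
by rewrite -big_mkcond/= (big_pred1 (en p s))// => v; rewrite eq_sym.
Qed.

Lemma qformM lam (c d : 'rV[R]_n) (u : P -> (R -> R) * (R -> R)) (w : P -> R -> R) :
  - lam0 <= lam <= 0 ->
  (forall p, piece_sol p lam (u p).1 (u p).2) ->
  (forall p s, (u p).1 (pt p s) = nval c (en p s)) ->
  (forall p s, w p (pt p s) = nval d (en p s)) ->
  qform (M lam) c d =
  \sum_p ((u p).2 (be p) * w p (be p) - (u p).2 (al p) * w p (al p)).
Proof.
move=> lamP us uc wd; rewrite /qform mxE.
rewrite (reindex_onto (@enum_rank Nd) enum_val) => [|i _]; last by rewrite enum_valK.
transitivity (\sum_v nval (c *m M lam) v * nval d v).
  apply: eq_big => v; first by rewrite enum_rankK eqxx.
  by move=> _; rewrite [X in _ * X]mxE.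
under eq_bigr do rewrite (ME lamP us uc).
rewrite sum_nodes; apply: eq_bigr => p _.
rewrite big_bool -!wd /flux/=; ring.
Qed.

Lemma M_sym lam : - lam0 <= lam <= 0 -> symmx (M lam).
Proof.
move=> lamP.
have qs (c d : 'rV[R]_n) : qform (M lam) c d = qform (M lam) d c.
  have [u [us uc]] := family_exists c lamP; have [w [ws wd]] := family_exists d lamP.
  rewrite (@qformM lam c d u (fun p => (w p).1))// (@qformM lam d c w (fun p => (u p).1))//.
  apply: eq_bigr => p _; apply/eqP; rewrite -subr_eq0.
  rewrite (green (ltW (al_be p)) (@ql_intg p lam) (@ql_intg p lam) (us p) (ws p)).
  under eq_itg do rewrite subrr mul0r.
  by rewrite itg_cst ?mul0r// ltW// al_be.
apply/matrixP => i j; have := qs (delta_mx 0 j) (delta_mx 0 i).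
by rewrite /qform -!rowE !trmx_delta -!colE !mxE => ->.
Qed.

Lemma nval_neq0 (c : 'rV[R]_n) : c != 0 -> exists v, nval c v != 0.
Proof.
move=> c0; apply: contrapT => H; move/negP: c0; apply; apply/eqP/rowP => i.
rewrite mxE; apply: contrapT => ci; apply: H; exists (enum_val i).
by rewrite /nval enum_valK; apply/eqP.
Qed.

Lemma M_decr s t (c : 'rV[R]_n) : - lam0 <= s -> s < t -> t <= 0 -> c != 0 ->
  qform (M t) c c < qform (M s) c c.
Proof.
move=> ls st t0 c0.
have sP : - lam0 <= s <= 0 by rewrite ls (le_trans _ t0)// ltW.
have tP : - lam0 <= t <= 0 by rewrite t0 (le_trans ls)// ltW.
have [u [us uc]] := family_exists c sP; have [w [ws wd]] := family_exists c tP.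
rewrite (@qformM s c c u (fun p => (u p).1))// (@qformM t c c w (fun p => (w p).1))//.
rewrite -subr_gt0 -sumrB.
have st0 : 0 < t - s by rewrite subr_gt0.
have Hp p : (t - s) * itg (al p) (be p) (fun x => (u p).1 x ^+ 2) <=
   (u p).2 (be p) * (u p).1 (be p) - (u p).2 (al p) * (u p).1 (al p) -
   ((w p).2 (be p) * (w p).1 (be p) - (w p).2 (al p) * (w p).1 (al p)).
  apply: (flux_decr (ltW (al_be p)) (qi p) _ (us p) (ws p)).
  - apply: le_trans (piece_small p tP) _; lra.
  - by rewrite -[al p]/(pt p false) uc wd.
  - by rewrite -[be p]/(pt p true) uc wd.
have I0 p : 0 <= itg (al p) (be p) (fun x => (u p).1 x ^+ 2).
  by apply: itg_ge0 => x _; exact: sqr_ge0.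
have [v v0] := nval_neq0 c0.
have [p [s' ps]] := touch v.
have Ip : 0 < itg (al p) (be p) (fun x => (u p).1 x ^+ 2).
  rewrite lt_neqAle I0 andbT eq_sym; apply/eqP => I00.
  have [_ bu1 uE _] := us p.
  have ptab := pt_in p s'.
  have := itg_sqr_eq0 (al_be p) uE bu1; rewrite I00 => /(_ (lexx _) _ ptab).
  by rewrite uc ps => /eqP; rewrite (negPf v0).
rewrite (bigD1 p)//=; apply: ltr_wpDr.
  by apply: sumr_ge0 => p' _; apply: le_trans (Hp p'); rewrite mulr_ge0// ltW.
by apply: lt_le_trans (Hp p); rewrite mulr_gt0.
Qed.

(** At [- lam0] the boundary form of each piece is nonnegative, and it vanishes
    only on the zero solution. *)
Lemma M_pos (c : 'rV[R]_n) : c != 0 -> 0 < qform (M (- lam0)) c c.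
Proof.
move=> c0.
have l0 := lam0_gt0.
have sP : - lam0 <= - lam0 <= 0 by rewrite lexx oppr_le0 ltW.
have [u [us uc]] := family_exists c sP.
rewrite (@qformM _ c c u (fun p => (u p).1))//.
have [v v0] := nval_neq0 c0; have [p [s' ps]] := touch v.
rewrite (bigD1 p)//=; apply: ltr_wpDr.
  by apply: sumr_ge0 => p' _; exact: flux_ge0 (us p') (lexx _).
rewrite lt_neqAle (flux_ge0 (us p) (lexx _)) andbT eq_sym; apply/eqP => F0.
have := flux_eq0 (us p) (lexx _); rewrite F0 => /(_ (lexx _) _ (pt_in p s')).
by rewrite uc ps => /eqP; rewrite (negPf v0).
Qed.

(** By the identity of Green the difference is, up to sign, [s - t] times the
    integral over all pieces of a product of solutions for [s] and for [t], and
    these are at most 4 in absolute value, as their boundary values are 0 or 1. *)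
Lemma M_cont s t i j : - lam0 <= s <= 0 -> - lam0 <= t <= 0 ->
  `|M s i j - M t i j| <= `|s - t| * (16 * h * #|P|%:R).
Proof.
move=> sP tP.
have [u [us uc]] := family_exists (delta_mx 0 i) sP.
have [w [ws wc]] := family_exists (delta_mx 0 j) tP.
have ij lam : M lam i j = qform (M lam) (delta_mx 0 i) (delta_mx 0 j).
  by rewrite /qform -rowE trmx_delta -colE !mxE.
rewrite (ij s) (ij t) (qformC _ _ (M_sym tP)).
rewrite (@qformM s _ _ u (fun p => (w p).1))// (@qformM t _ _ w (fun p => (u p).1))//.
rewrite -sumrB.
apply: le_trans (ler_norm_sum _ _ _) _.
have -> : `|s - t| * (16 * h * #|P|%:R) = \sum_(p : P) `|s - t| * (16 * h).
  by rewrite sumr_const -[RHS]mulr_natr; ring.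
apply: ler_sum => p _; have ab := ltW (al_be p).
rewrite (green ab (@ql_intg p s) (@ql_intg p t) (us p) (ws p)).
have [bu _ _ _] := us p; have [bw _ _ _] := ws p.
have Qi : intg (al p) (be p) (fun x => (q p x - s - (q p x - t)) * ((u p).1 x * (w p).1 x)).
  by apply: intgM; [apply: intgB; exact: ql_intg|exact: bmfM].
apply: le_trans (norm_itg Qi) _.
have d1 (k : 'I_n) v : `|nval (delta_mx 0 k : 'rV[R]_n) v| <= 1.
  by rewrite /nval mxE eqxx/=; case: eqP; rewrite ?normr1 ?normr0.
have bnd lam (z : P -> (R -> R) * (R -> R)) k : - lam0 <= lam <= 0 ->
    (forall p, piece_sol p lam (z p).1 (z p).2) ->
    (forall p s, (z p).1 (pt p s) = nval (delta_mx 0 k : 'rV[R]_n) (en p s)) ->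
    forall x, al p <= x <= be p -> `|(z p).1 x| <= 4.
  move=> lamP zs zc x xab.
  have := sol_bound (al_be p) (@ql_intg p lam) (piece_small p lamP) (zs p) xab.
  rewrite -[al p]/(pt p false) -[be p]/(pt p true) !zc.
  by have := d1 k (en p false); have := d1 k (en p true); lra.
apply: (@le_trans _ _ (itg (al p) (be p) (fun=> `|s - t| * 16))).
  apply: le_itg; [exact: intg_norm|exact: intg_cst|].
  move=> x xab; rewrite !normrM; apply: ler_pM => //.
    by rewrite distrC le_eqVlt; apply/predU1P; left; congr (`|_|); ring.
  rewrite (_ : 16 = 4 * 4 :> R); last by rewrite -natrM.
  by apply: ler_pM => //; [exact: bnd sP us uc _ xab|exact: bnd tP ws wc _ xab].
rewrite itg_cst// beE le_eqVlt; apply/predU1P; left; ring.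
Qed.

Variables (r : Nd) (kap : R -> R).
Hypotheses (kap_ge0 : forall t, t <= 0 -> 0 <= kap t)
  (kap_decr : forall s t, s <= t -> t <= 0 -> kap t <= kap s)
  (kap_cont : forall t, t <= 0 -> forall e, 0 < e -> exists2 d, 0 < d &
     forall s, s <= 0 -> `|s - t| < d -> `|kap s - kap t| <= e).

(** The extra term imposes that the derivatives leaving the node [r] add up to
    [kap lam] times the value at [r]. *)
Definition robin lam := M lam + kap lam *: delta_mx (enum_rank r) (enum_rank r).

Lemma qform_robin lam (c d : 'rV[R]_n) :
  qform (robin lam) c d = qform (M lam) c d + kap lam * (nval c r * nval d r).
Proof.
rewrite /robin qformDm; congr (_ + _).
rewrite qformE (bigD1 (enum_rank r))//= [X in _ + X]big1 => [|i ir]; last first.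
  by rewrite big1// => j _; rewrite !mxE (negPf ir)/= !mulr0 mul0r.
rewrite addr0 (bigD1 (enum_rank r))//= big1 => [|j jr]; last first.
  by rewrite !mxE (negPf jr) andbF !mulr0 mul0r.
by rewrite !mxE !eqxx/= /nval; ring.
Qed.

Lemma robin_kerE lam (c : 'rV[R]_n) v :
  nval (c *m robin lam) v = nval (c *m M lam) v + (v == r)%:R * (kap lam * nval c r).
Proof.
rewrite /nval /robin mulmxDr [LHS]mxE; congr (_ + _).
rewrite -scalemxAr mxE mxE (bigD1 (enum_rank r))//= big1 => [|i ir]; last first.
  by rewrite mxE (negPf ir)/= mulr0.
rewrite mxE eqxx/= (inj_eq enum_rank_inj) addr0; ring.
Qed.

Lemma robin_count :
  \esum_(t in [set t | - lam0 < t < 0]) (nullity (robin t))%:R%:E =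
  (neg_index (robin 0))%:R%:E :> \bar R.
Proof.
have l0 := lam0_gt0.
apply: sum_nullity.
- by rewrite oppr_lt0.
- move=> t tP; rewrite /symmx /robin linearD/= (M_sym tP) linearZ/=.
  by rewrite trmx_delta.
- move=> s t ls st t0 v v0; rewrite !qform_robin.
  apply: ltr_leD; first exact: M_decr.
  apply: ler_wpM2r; first by rewrite -expr2 sqr_ge0.
  by apply: kap_decr => //; exact: ltW.
- move=> t tP e e0; have /andP[_ t0] := tP.
  have e20 : 0 < e / 2 by rewrite divr_gt0.
  have [d d0 Hd] := kap_cont t0 e20.
  pose C := 16 * h * #|P|%:R + 1.
  have C0 : 0 < C by rewrite /C ltr_wpDl// mulr_ge0 ?ler0n// mulr_ge0// ltW.
  exists (Num.min d (e / 2 / C)); first by rewrite lt_min d0 divr_gt0.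
  move=> s sP; rewrite lt_min => /andP[sd sC] i j; have /andP[_ s0] := sP.
  have H1 := M_cont i j sP tP; have H2 := Hd s s0 sd.
  have H3 : `|s - t| * (16 * h * #|P|%:R) <= e / 2.
    rewrite ltr_pdivlMr// in sC; apply: le_trans (ltW sC).
    by rewrite /C mulrDr lerDl mulr1.
  rewrite /robin !mxE opprD addrACA.
  apply: le_trans (ler_normD _ _) _.
  rewrite [leRHS](_ : e = e / 2 + e / 2); last by field.
  apply: lerD; first exact: le_trans H1 H3.
  rewrite -mulrBl normrM; apply: le_trans H2; rewrite ler_piMr//.
  by case: (_ && _); rewrite ?normr1 ?normr0.
- move=> v v0; rewrite qform_robin; apply: ltr_wpDr; last exact: M_pos.
  by rewrite mulr_ge0// -?expr2 ?sqr_ge0// kap_ge0// oppr_le0 ltW.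
Qed.

End matrix.
End dtn.

(** * Multiplicities as nullities of real matrices *)

Lemma ae_imp (R : realType) (P Q : R -> Prop) :
  {ae (@lebesgue_measure R), forall x, P x} -> (forall x, P x -> Q x) ->
  {ae (@lebesgue_measure R), forall x, Q x}.
Proof.
by move=> HP PQ; apply: negligibleS HP => x /= nQ /PQ.
Qed.

(** The real eigenfunctions for [lam] form a real vector space [S], and both the
    real and the imaginary part of a complex eigenfunction belong to it. If [S] is
    identified with the kernel of a real matrix [B] by evaluation at finitely many
    points [ev], then the complex multiplicity is the nullity of [B], since the rank
    of a real matrix is the same over the complex numbers. *)

Section multiplicity.
Local Open Scope complex_scope.
Context {R : realType} (I : finType) (n : nat).
Variables (D : I -> set R) (A : @operator R I) (lam : R).
Variables (S : set (I -> R -> R)) (ev : 'I_n -> I * R) (B : 'M[R]_n).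
Local Notation Re := (@complex.Re R).
Local Notation Im := (@complex.Im R).
Hypotheses
  (S_lin : forall k (f g : I -> R -> R), S f -> S g ->
     S (fun j x => k * f j x + g j x))
  (S_0 : S (fun _ _ => 0))
  (eig_Re : forall y, eigenspace A lam y -> S (fun j x => Re (y j x)))
  (eig_Im : forall y, eigenspace A lam y -> S (fun j x => Im (y j x)))
  (S_eig : forall f, S f -> eigenspace A lam (fun j x => (f j x)%:C))
  (S_ker : forall f, S f -> (\row_v f (ev v).1 (ev v).2) *m B = 0)
  (ker_S : forall C : 'rV_n, C *m B = 0 ->
     exists2 f, S f & forall v, f (ev v).1 (ev v).2 = C 0 v)
  (S_ae : forall f, S f ->
     (forall j, {ae (@lebesgue_measure R), forall x, D j x -> f j x = 0}) ->
     forall v, f (ev v).1 (ev v).2 = 0)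
  (S_tr : forall f, S f -> (forall v, f (ev v).1 (ev v).2 = 0) ->
     forall j x, D j x -> f j x = 0).

Lemma S_sum (m : nat) (k : 'I_m -> R) (f : 'I_m -> I -> R -> R) :
  (forall i, S (f i)) -> S (fun j x => \sum_i k i * f i j x).
Proof.
move=> Sf; elim: m k f Sf => [|m IH] k f Sf.
  have -> : (fun j x => \sum_(i < 0) k i * f i j x) = (fun _ _ => 0).
    by apply/funext => j; apply/funext => x; rewrite big_ord0.
  exact: S_0.
have -> : (fun j x => \sum_(i < m.+1) k i * f i j x) =
    (fun j x => k ord0 * f ord0 j x + \sum_(i < m) k (lift ord0 i) * f (lift ord0 i) j x).
  by apply/funext => j; apply/funext => x; rewrite big_ord_recl.
by apply: S_lin => //; apply: (IH (fun i => k (lift ord0 i)) (fun i => f (lift ord0 i))).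
Qed.

Lemma Re_sum (J : finType) (F : J -> R[i]) : Re (\sum_j F j) = \sum_j Re (F j).
Proof. exact: (raddf_sum (@complex.Re R : {additive R[i] -> R})). Qed.
Lemma Im_sum (J : finType) (F : J -> R[i]) : Im (\sum_j F j) = \sum_j Im (F j).
Proof. exact: (raddf_sum (@complex.Im R : {additive R[i] -> R})). Qed.

Lemma ReM (x y : R[i]) : Re (x * y) = Re x * Re y - Im x * Im y.
Proof. by case: x y => a b [c d]. Qed.
Lemma ImM (x y : R[i]) : Im (x * y) = Re x * Im y + Im x * Re y.
Proof. by case: x y => a b [c d]. Qed.
Lemma complexP (x : R[i]) : Re x = 0 -> Im x = 0 -> x = 0.
Proof. by case: x => a b /= -> ->. Qed.

Lemma multiplicity_le m (b : 'I_m -> I -> R -> R[i]) :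
  (forall k, eigenspace A lam (b k)) -> lin_indep D b -> (m <= nullity B)%N.
Proof.
move=> be bi.
pose X := \matrix_(k, v) b k (ev v).1 (ev v).2.
pose BC := map_mx (real_complex R) B.
have XB : X *m BC = 0.
  apply/matrixP => k v; rewrite mxE [RHS]mxE; apply: complexP.
    rewrite Re_sum.
    have := congr1 (fun M : 'rV_n => M 0 v) (S_ker (eig_Re (be k))).
    rewrite !mxE => H0; rewrite -[RHS]H0; apply: eq_bigr => w _; rewrite !mxE ReM /=; ring.
  rewrite Im_sum.
  have := congr1 (fun M : 'rV_n => M 0 v) (S_ker (eig_Im (be k))).
  rewrite !mxE => H0; rewrite -[RHS]H0; apply: eq_bigr => w _; rewrite !mxE ImM /=; ring.
have Xfree : row_free X.
  rewrite -kermx_eq0; apply/rowV0P => d /sub_kermxP dX.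
  apply/rowP => k; rewrite [RHS]mxE.
  have := bi (fun k => d 0 k); apply => j; apply: aeW => x Dx.
  have dXv v : \sum_k d 0 k * b k (ev v).1 (ev v).2 = 0.
    have := congr1 (fun M : 'rV_n => M 0 v) dX; rewrite !mxE => dv.
    by rewrite -[RHS]dv; apply: eq_bigr => i _; rewrite mxE.
  pose fr j x := \sum_k Re (d 0 k) * Re (b k j x).
  pose fi j x := \sum_k - Im (d 0 k) * Im (b k j x).
  pose gr j x := \sum_k Re (d 0 k) * Im (b k j x).
  pose gi j x := \sum_k Im (d 0 k) * Re (b k j x).
  have Sfr : S fr by apply: S_sum => i; exact: eig_Re.
  have Sfi : S fi by apply: S_sum => i; exact: eig_Im.
  have Sgr : S gr by apply: S_sum => i; exact: eig_Im.
  have Sgi : S gi by apply: S_sum => i; exact: eig_Re.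
  have fE j' x' : 1 * fr j' x' + fi j' x' = Re (\sum_k d 0 k * b k j' x').
    rewrite Re_sum mul1r /fr /fi -big_split/=; apply: eq_bigr => i _.
    by rewrite ReM mulNr.
  have gE j' x' : 1 * gr j' x' + gi j' x' = Im (\sum_k d 0 k * b k j' x').
    rewrite Im_sum mul1r /gr /gi -big_split/=; apply: eq_bigr => i _.
    by rewrite ImM.
  apply: complexP.
    by rewrite -fE; apply: (S_tr (S_lin 1 Sfr Sfi)) => // v; rewrite fE dXv.
  by rewrite -gE; apply: (S_tr (S_lin 1 Sgr Sgi)) => // v; rewrite gE dXv.
have XK : (X <= kermx BC)%MS by apply/sub_kermxP.
have := mxrankS XK; rewrite (eqP Xfree) => /leq_trans; apply.
by rewrite /nullity -(mxrank_map (real_complex R)) map_kermx.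
Qed.

Lemma multiplicity_ge : exists b : 'I_(nullity B) -> I -> R -> R[i],
  (forall k, eigenspace A lam (b k)) /\ lin_indep D b.
Proof.
pose C := row_base (kermx B).
have CB : C *m B = 0 by apply/sub_kermxP; rewrite eq_row_base.
have fex (k : 'I_(nullity B)) : exists f, S f /\ forall v, f (ev v).1 (ev v).2 = C k v.
  have [|f Sf fC] := ker_S (C := row k C); first by rewrite -row_mul CB row0.
  by exists f; split=> // v; rewrite fC mxE.
have [f fP] := choice fex.
exists (fun k j x => (f k j x)%:C); split=> [k|d dz].
  by apply: S_eig; have [] := fP k.
have real0 (e : 'I_(nullity B) -> R) :
    (forall j, {ae (@lebesgue_measure R), forall x, D j x -> \sum_k e k * f k j x = 0}) ->
    forall k, e k = 0.
  move=> ez.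
  have Se : S (fun j x => \sum_k e k * f k j x).
    by apply: S_sum => k; have [] := fP k.
  have e0 := S_ae Se ez.
  have : (\row_k e k) *m C = 0.
    apply/rowP => v; rewrite mxE [RHS]mxE -[RHS](e0 v); apply: eq_bigr => k _.
    by rewrite mxE; have [_ ->] := fP k.
  move=> /eqP; rewrite mulmx_free_eq0 ?row_base_free// => /eqP e00 k.
  by have := congr1 (fun M : 'rV_(nullity B) => M 0 k) e00; rewrite !mxE.
move=> k; apply: complexP.
  apply: (real0 (fun k => Re (d k))) => j; apply: (ae_imp (dz j)) => x + Dx => /(_ Dx) H.
  have := congr1 Re H; rewrite Re_sum => H'; rewrite -[RHS]H'.
  by apply: eq_bigr => i _; rewrite ReM/=; ring.
apply: (real0 (fun k => Im (d k))) => j; apply: (ae_imp (dz j)) => x + Dx => /(_ Dx) H.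
have := congr1 Im H; rewrite Im_sum => H'; rewrite -[RHS]H'.
by apply: eq_bigr => i _; rewrite ImM/=; ring.
Qed.

Lemma multiplicityE : multiplicity D A lam = (nullity B)%:R%:E.
Proof.
apply/eqP; rewrite eq_le; apply/andP; split.
  apply: ge_ereal_sup => _ [m [b [be bi]] <-].
  by rewrite lee_fin ler_nat; exact: multiplicity_le be bi.
by apply: ereal_sup_ubound; exists (nullity B) => //; exact: multiplicity_ge.
Qed.

End multiplicity.

(** * Gluing solutions *)

Section gluing.
Context {R : realType}.
Implicit Types (a b c : R) (f u v Q : R -> R).

Lemma sol_sub Q a b a' b' u u1 : a <= a' -> b' <= b -> intg a b Q ->
  sol Q a b u u1 -> sol Q a' b' u u1.
Proof.
move=> aa bb Qi [bu bu1 uE u1E]; split.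
- exact: bmf_sub bu.
- exact: bmf_sub bu1.
- exact: prim_sub (intg_bmf bu1) uE.
- exact: prim_sub (intgM Qi bu) u1E.
Qed.

Definition glue b u v x := if x <= b then u x else v x.

Lemma glue_bmf a b c u v : a <= b -> b <= c -> bmf a b u -> bmf b c v ->
  bmf a c (glue b u v).
Proof.
move=> ab bc [mu [C HC]] [mv [D HD]]; split.
  have -> : `[a, c]%classic = `[a, b] `|` `]b, c].
    by rewrite -itv_bndbnd_setU// bnd_simp.
  apply/measurable_funU => //; split.
    apply: eq_measurable_fun mu => x; rewrite inE/= in_itv/= => /andP[_ xb].
    by rewrite /glue xb.
  apply: eq_measurable_fun (measurable_funS _ _ mv) => // [x|].
    by rewrite inE/= in_itv/= => /andP[xb _]; rewrite /glue leNgt xb.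
  by apply: subset_itv; rewrite bnd_simp.
exists (Num.max C D) => x /andP[ax xc]; rewrite /glue le_max.
by case: (leP x b) => xb; [rewrite HC ?ax//|rewrite HD ?orbT// ltW].
Qed.

Lemma eq_prim a b u f g : (forall x, a <= x <= b -> f x = g x) ->
  prim a b u f -> prim a b u g.
Proof.
move=> fg uE x /andP[ax xb]; rewrite uE ?ax//; congr (_ + _).
by apply: eq_itg => t /andP[at_ tx]; rewrite fg// at_ (le_trans tx).
Qed.

Lemma glue_prim a b c u v f : a <= b -> b <= c -> u b = v b -> intg a c f ->
  prim a b u f -> prim b c v f -> prim a c (glue b u v) f.
Proof.
move=> ab bc uv fi uE vE x /andP[ax xc]; rewrite /glue ab.
case: (leP x b) => xb; first by rewrite uE ?ax.
rewrite vE ?(ltW xb)// -uv uE ?ab ?lexx// -addrA -itg_chasles// ?ltW//.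
exact: intg_sub xc fi.
Qed.

Lemma glue_l b u v x : x <= b -> glue b u v x = u x.
Proof. by rewrite /glue => ->. Qed.

Lemma glue_r b u v x : u b = v b -> b <= x -> glue b u v x = v x.
Proof. by rewrite /glue le_eqVlt => uv /predU1P[<-|bx]; [rewrite lexx|rewrite leNgt bx]. Qed.

Lemma glue_sol Q a b c u u1 v v1 : a <= b -> b <= c -> intg a c Q ->
  u b = v b -> u1 b = v1 b -> sol Q a b u u1 -> sol Q b c v v1 ->
  sol Q a c (glue b u v) (glue b u1 v1).
Proof.
move=> ab bc Qi uv uv1 [bu bu1 uE u1E] [bv bv1 vE v1E].
have bw := glue_bmf ab bc bu bv; have bw1 := glue_bmf ab bc bu1 bv1.
split=> //; apply: glue_prim => //.
- exact: intg_bmf.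
- by apply: eq_prim uE => x /andP[_ xb]; rewrite glue_l.
- by apply: eq_prim vE => x /andP[bx _]; rewrite glue_r.
- exact: intgM.
- by apply: eq_prim u1E => x /andP[_ xb]; rewrite glue_l.
- by apply: eq_prim v1E => x /andP[bx _]; rewrite glue_r.
Qed.

(** When the values and the derivatives match at the cut points, the integrated
    equation carries over from each interval to the next. *)
Lemma glue_seq Q (t : nat -> R) (u u1 : nat -> R -> R) m :
  (forall i, t i <= t i.+1) -> intg (t 0%N) (t m.+1) Q ->
  (forall i, (i <= m)%N -> sol Q (t i) (t i.+1) (u i) (u1 i)) ->
  (forall i, (i < m)%N -> u i (t i.+1) = u i.+1 (t i.+1) /\
                         u1 i (t i.+1) = u1 i.+1 (t i.+1)) ->
  exists w w1, [/\ sol Q (t 0%N) (t m.+1) w w1,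
    w (t 0%N) = u 0%N (t 0%N),
    forall i, (i <= m)%N -> w (t i.+1) = u i (t i.+1),
    w1 (t 0%N) = u1 0%N (t 0%N) & w1 (t m.+1) = u1 m (t m.+1)].
Proof.
move=> tS; have tle i j : (i <= j)%N -> t i <= t j.
  by move=> ij; exact: (homo_leq (@lexx _ R) (@le_trans _ R)).
elim: m => [|m IH] Qi us um.
  exists (u 0%N), (u1 0%N); split=> // [|i]; first exact: us.
  by rewrite leqn0 => /eqP ->.
have [|||w [w1 [ws w0 wi w10 w1m]]] := IH.
- by apply: intg_sub Qi => //; exact: tle.
- by move=> i im; apply: us; exact: leqW.
- by move=> i im; apply: um; exact: leqW.
have [uE u1E] := um m (ltnSn m).
have we : w (t m.+1) = u m.+1 (t m.+1) by rewrite wi.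
have w1e : w1 (t m.+1) = u1 m.+1 (t m.+1) by rewrite w1m.
exists (glue (t m.+1) w (u m.+1)), (glue (t m.+1) w1 (u1 m.+1)); split.
- by apply: glue_sol => //; [exact: tle|exact: us].
- by rewrite glue_l// tle.
- move=> i; rewrite leq_eqVlt => /predU1P[->|im]; first by rewrite glue_r.
  by rewrite glue_l ?wi// tle.
- by rewrite glue_l// tle.
- by rewrite glue_r.
Qed.

End gluing.

(** * Subdivision of a rooted tree *)

Section pieces.
Variables (T : rooted_tree) (N' : nat).
Local Notation N := N'.+1.
Definition piece : finType := (edge T * 'I_N)%type.
Definition node : finType := (vertex T + edge T * 'I_N')%type.

(** The inner cut points of the edge [e] are [inr (e, j)]. The left end of the piece
    [i] is the cut [i - 1] and its right end is the cut [i], unless these are ends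
    of the edge; this is what [unlift] computes. *)
Definition piece_end (p : piece) (s : bool) : node :=
  if unlift (if s then ord_max else ord0) p.2 is Some j then inr (p.1, j)
  else inl (if s then tterm p.1 else tinit p.1).

Lemma piece_end0 e : piece_end (e, ord0) false = inl (tinit e).
Proof. by rewrite /piece_end/= unlift_none. Qed.
Lemma piece_end_max e : piece_end (e, ord_max) true = inl (tterm e).
Proof. by rewrite /piece_end/= unlift_none. Qed.
Lemma piece_end_lift0 e j : piece_end (e, lift ord0 j) false = inr (e, j).
Proof. by rewrite /piece_end/= liftK. Qed.
Lemma piece_end_lift_max e j : piece_end (e, lift ord_max j) true = inr (e, j).
Proof. by rewrite /piece_end/= liftK. Qed.

Lemma piece_end_inl p s v : (piece_end p s == inl v) =
  if s then (p.2 == ord_max) && (tterm p.1 == v)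
  else (p.2 == ord0) && (tinit p.1 == v).
Proof.
case: p s => e i [] /=.
  case: (unliftP ord_max i) => [j|] ->; last by rewrite piece_end_max eqxx.
  by rewrite piece_end_lift_max [lift _ _ == _]eq_sym (negPf (neq_lift _ _)).
case: (unliftP ord0 i) => [j|] ->; last by rewrite piece_end0 eqxx.
by rewrite piece_end_lift0 [lift _ _ == _]eq_sym (negPf (neq_lift _ _)).
Qed.

Lemma piece_end_inr p s e j : (piece_end p s == inr (e, j)) =
  (p == (e, lift (if s then ord_max else ord0) j)).
Proof.
case: p s => e' i [] /=.
  case: (unliftP ord_max i) => [k|] ->.
    by rewrite piece_end_lift_max -[LHS]/((e', k) == (e, j)) !xpair_eqE (inj_eq lift_inj).
  by rewrite piece_end_max xpair_eqE (negPf (neq_lift _ _)) andbF.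
case: (unliftP ord0 i) => [k|] ->.
  by rewrite piece_end_lift0 -[LHS]/((e', k) == (e, j)) !xpair_eqE (inj_eq lift_inj).
by rewrite piece_end0 xpair_eqE (negPf (neq_lift _ _)) andbF.
Qed.

Lemma sum_pend_inl (R : realType) (F : piece -> bool -> R) v :
  \sum_p \sum_(s | piece_end p s == inl v) F p s =
  \sum_(e | tterm e == v) F (e, ord_max) true + \sum_(e | tinit e == v) F (e, ord0) false.
Proof.
have -> : \sum_p \sum_(s | piece_end p s == inl v) F p s =
    \sum_p (if (p.2 == ord_max) && (tterm p.1 == v) then F p true else 0) +
    \sum_p (if (p.2 == ord0) && (tinit p.1 == v) then F p false else 0).
  rewrite -big_split/=; apply: eq_bigr => p _.
  by rewrite big_mkcond/= big_bool !piece_end_inl.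
congr (_ + _).
  rewrite -big_mkcond (reindex_onto (fun e => (e, ord_max : 'I_N)) fst)/=.
    by apply: eq_bigl => e; rewrite !eqxx/= andbT.
  by case=> e i /= /andP[/eqP -> _].
rewrite -big_mkcond (reindex_onto (fun e => (e, ord0 : 'I_N)) fst)/=.
  by apply: eq_bigl => e; rewrite !eqxx/= andbT.
by case=> e i /= /andP[/eqP -> _].
Qed.

Lemma sum_pend_inr (R : realType) (F : piece -> bool -> R) e j :
  \sum_p \sum_(s | piece_end p s == inr (e, j)) F p s =
  F (e, lift ord_max j) true + F (e, lift ord0 j) false.
Proof.
have -> : \sum_p \sum_(s | piece_end p s == inr (e, j)) F p s =
    \sum_p (if p == (e, lift ord_max j) then F p true else 0) +
    \sum_p (if p == (e, lift ord0 j) then F p false else 0).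
  rewrite -big_split/=; apply: eq_bigr => p _.
  by rewrite big_mkcond/= big_bool !piece_end_inr.
by congr (_ + _); rewrite -big_mkcond big_pred1_eq.
Qed.

Lemma root_out : exists e : edge T, tinit e = root T.
Proof.
have [u uroot] : exists u : vertex T, u != root T.
  have := tree_gt1 T; rewrite (cardD1 (root T)) inE/= add1n ltnS => /card_gt0P[u].
  by rewrite !inE andbT; exists u.
have /connectP[[|w p] /=] := tree_directed u.
  by move=> _ uE; rewrite uE eqxx in uroot.
by move=> /andP[/existsP[e /andP[/eqP er _]] _] _; exists e.
Qed.

Lemma piece_end_touch v : exists p s, piece_end p s = v.
Proof.
case: v => [v|[e j]]; last by exists (e, lift ord0 j), false; rewrite piece_end_lift0.
have [->|vr] := eqVneq v (root T).
  by have [e <-] := root_out; exists (e, ord0), false; rewrite piece_end0.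
have [_ _ /(_ v vr)[e <-]] := incoming_edge T.
by exists (e, ord_max), true; rewrite piece_end_max.
Qed.

End pieces.

(** * Solutions on the tree and their node values *)

Section tree_solutions.
Context {R : realType} (T : rooted_tree) (l : R) (q : edge T -> R -> R).
Hypothesis (l0 : 0 < l) (qi : forall j, intg 0 l (q j)).

(** [c] gives the values at the vertices, which encodes continuity. The balance of
    the derivatives holds at all vertices, with a Robin term at the root: the
    value [kap = 0] gives the conditions of L_N, and [kap = sqrt (- lam)] those
    that L_oo induces on the tree. *)
Definition tree_sol (lam kap : R) (c : vertex T -> R) (y y1 : edge T -> R -> R) :=
  [/\ forall j, sol (fun t => q j t - lam) 0 l (y j) (y1 j),
      forall j, y j 0 = c (tinit j) /\ y j l = c (tterm j) &
      forall v, \sum_(j | tterm j == v) y1 j l - \sum_(k | tinit k == v) y1 k 0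
                + (v == root T)%:R * (kap * c (root T)) = 0].

Lemma tree_sol0 lam kap : tree_sol lam kap (fun=> 0) (fun _ _ => 0) (fun _ _ => 0).
Proof.
split=> // [j|v].
  have z : prim 0 l (fun=> 0 : R) (fun=> 0).
    by move=> x /andP[x0 _]; rewrite itg_cst// mul0r addr0.
  split=> //; try exact: bmf_cst.
  by apply: eq_prim z => x _; rewrite mulr0.
by rewrite !big1// !mulr0 subrr addr0.
Qed.

Lemma tree_sol_lin lam kap k c y y1 d z z1 : tree_sol lam kap c y y1 -> tree_sol lam kap d z z1 ->
  tree_sol lam kap (fun v => k * c v + d v) (fun j x => k * y j x + z j x)
    (fun j x => k * y1 j x + z1 j x).
Proof.
move=> [ys yc yk] [zs zc zk]; split=> [j|j|v].
- have Qi : intg 0 l (fun t => q j t - lam) by apply: intgB => //; exact: intg_cst.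
  by apply: solD => //; exact: solZ.
- by have [-> ->] := yc j; have [-> ->] := zc j.
- have := zk v; have := yk v; rewrite !big_split/= -!mulr_sumr.
  set a1 := \sum_(j | _) y1 j l; set a2 := \sum_(j | _) y1 j 0.
  set b1 := \sum_(j | _) z1 j l; set b2 := \sum_(j | _) z1 j 0.
  by move=> Ha Hb; transitivity (k * (a1 - a2 + (v == root T)%:R * (kap * c (root T)))
     + (b1 - b2 + (v == root T)%:R * (kap * d (root T)))); [ring|rewrite Ha Hb mulr0 addr0].
Qed.

Variables (N' : nat) (K : R).
Local Notation N := N'.+1.
Local Notation h := (l / N%:R).
Hypotheses (K0 : 0 < K) (hK : h * K <= 20^-1)
  (qK : forall j, itg 0 l (fun t => `|q j t|) <= K).

Local Notation P := (piece T N').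
Local Notation Nd := (node T N').
Definition grid (i : nat) := i%:R * h.
Definition al (p : P) : R := grid p.2.
Definition be (p : P) : R := grid p.2.+1.
Definition piece_pot (p : P) := q p.1.

Lemma h_gt0 : 0 < h. Proof. by rewrite divr_gt0. Qed.

Lemma beE p : be p = al p + h.
Proof. by rewrite /be /al /grid -natr1; ring. Qed.

Lemma grid0 : grid 0 = 0. Proof. by rewrite /grid mul0r. Qed.
Lemma gridN : grid N = l. Proof. by rewrite /grid mulrCA divff ?mulr1// pnatr_eq0. Qed.
Lemma grid_le i j : (i <= j)%N -> grid i <= grid j.
Proof. by move=> ij; rewrite ler_pM2r ?h_gt0// ler_nat. Qed.

Lemma al_ge0 p : 0 <= al p. Proof. by rewrite -grid0 grid_le. Qed.
Lemma be_le p : be p <= l. Proof. by rewrite -gridN grid_le. Qed.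
Lemma al_le_be p : al p <= be p. Proof. exact: grid_le. Qed.

Lemma piece_pot_intg p : intg (al p) (be p) (piece_pot p).
Proof. by apply: intg_sub (qi p.1); [exact: al_ge0|exact: be_le]. Qed.

Lemma piece_pot_K p : itg (al p) (be p) (fun t => `|piece_pot p t|) <= K.
Proof.
by apply: le_trans (qK p.1); apply: itg_norm_sub;
  [exact: al_ge0|exact: al_le_be|exact: be_le|exact: qi].
Qed.

Lemma grid_cover x : 0 <= x <= l -> exists i : 'I_N, grid i <= x <= grid i.+1.
Proof.
move=> /andP[x0 xl].
suff H m : (m <= N)%N -> grid m <= x \/ exists i : 'I_N, grid i <= x <= grid i.+1.
  have [|//] := H N (leqnn _); rewrite gridN => lx.
  exists ord_max; rewrite gridN xl andbT; apply: le_trans lx.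
  by rewrite -gridN grid_le.
elim: m => [_|m IH mN]; first by left; rewrite grid0.
have [gm|] := IH (ltnW mN); last by right.
have [gm1|xg] := leP (grid m.+1) x; first by left.
by right; exists (Ordinal mN); rewrite gm ltW.
Qed.

Lemma grid_zero (y : edge T -> R -> R) :
  (forall p x, al p <= x <= be p -> y p.1 x = 0) ->
  forall j x, 0 <= x <= l -> y j x = 0.
Proof. by move=> H j x /grid_cover[i ix]; exact: (H (j, i)). Qed.

Definition node_val (c : vertex T -> R) (y : edge T -> R -> R) (v : Nd) : R :=
  match v with inl v => c v | inr (e, j) => y e (grid j.+1) end.

Section one.
Variables (lam kap : R) (c : vertex T -> R) (y y1 : edge T -> R -> R).
Hypothesis ts : tree_sol lam kap c y y1.

Lemma tree_sol_piece_sol p : piece_sol al be piece_pot p lam (y p.1) (y1 p.1).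
Proof.
have [ys _ _] := ts; apply: sol_sub (ys p.1); [exact: al_ge0|exact: be_le|].
by apply: intgB => //; exact: intg_cst.
Qed.

Lemma tree_sol_node p s : y p.1 (pt al be p s) = node_val c y (piece_end p s).
Proof.
have [_ yc _] := ts; case: p s => e i [] /=.
  rewrite /be/=; case: (unliftP ord_max i) => [j|] ->.
    by rewrite piece_end_lift_max/= /bump leqNgt ltn_ord add0n.
  by rewrite piece_end_max/= gridN; have [] := yc e.
rewrite /al/=; case: (unliftP ord0 i) => [j|] ->.
  by rewrite piece_end_lift0/=.
by rewrite piece_end0/= grid0; have [] := yc e.
Qed.

Lemma tree_sol_kirchhoff v :
  \sum_p \sum_(s | piece_end p s == v) flux al be p s (y1 p.1) +
  (v == inl (root T))%:R * (kap * c (root T)) = 0.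
Proof.
have [_ _ yk] := ts; case: v => [v|[e j]].
  rewrite sum_pend_inl -[RHS](yk v); congr (_ + _); congr (_ + _).
    by apply: eq_bigr => e _; rewrite /flux/= mul1r /be/= gridN.
  rewrite -sumrN; apply: eq_bigr => e _.
  by rewrite /flux/= /al/= grid0 mulN1r.
rewrite sum_pend_inr /flux/= mul0r addr0 /al /be/= /bump leqNgt ltn_ord add0n leq0n add1n; ring.
Qed.

(** By the balance at the nodes, the boundary forms of the pieces add up to
    [- kap * c (root T) ^+ 2 <= 0]; being nonnegative, they are all zero. *)
Lemma tree_sol_low : 0 <= kap -> lam <= - lam0 h K ->
  forall j x, 0 <= x <= l -> y j x = 0.
Proof.
move=> k0 lamP.
pose F p := y1 p.1 (be p) * y p.1 (be p) - y1 p.1 (al p) * y p.1 (al p).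
have F0 p : 0 <= F p.
  exact: (flux_ge0 h_gt0 K0 hK beE piece_pot_intg piece_pot_K (tree_sol_piece_sol p) lamP).
have sF : \sum_p F p = - (kap * c (root T) ^+ 2).
  transitivity (\sum_v (\sum_p \sum_(s | piece_end p s == v) flux al be p s (y1 p.1)) * node_val c y v).
    rewrite sum_nodes; apply: eq_bigr => p _.
    by rewrite big_bool -!tree_sol_node /flux/F/=; ring.
  rewrite (bigD1 (inl (root T) : Nd))//= [X in _ + X]big1 => [|v vr].
    have := tree_sol_kirchhoff (inl (root T)); rewrite eqxx mul1r => /eqP.
    by rewrite addr_eq0 => /eqP ->; rewrite /=; ring.
  by have := tree_sol_kirchhoff v; rewrite (negPf vr) mul0r addr0 => ->; rewrite mul0r.
have Fz p : F p <= 0.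
  apply: (@le_trans _ _ (\sum_p F p)).
    by rewrite (bigD1 p)//= lerDl sumr_ge0.
  by rewrite sF oppr_le0 mulr_ge0// sqr_ge0.
have yz p x : al p <= x <= be p -> y p.1 x = 0.
  exact: (flux_eq0 h_gt0 K0 hK beE piece_pot_intg piece_pot_K (tree_sol_piece_sol p) lamP (Fz p)).
exact: grid_zero.
Qed.

End one.

Section kernel.
Variables (M : R -> 'M[R]_#|Nd|) (kf : R -> R) (lam : R).
Hypotheses (ME : forall lam, - lam0 h K <= lam <= 0 ->
  forall (c : 'rV_#|Nd|) (u u1 : P -> R -> R),
    (forall p, piece_sol al be piece_pot p lam (u p) (u1 p)) ->
    (forall p s, u p (pt al be p s) = nval c (piece_end p s)) ->
  forall v, nval (c *m M lam) v =
    \sum_p \sum_(s : bool | piece_end p s == v) flux al be p s (u1 p)).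
Hypothesis lamP : - lam0 h K <= lam <= 0.
Local Notation root_node := (inl (root T) : Nd).
Local Notation B := (robin M root_node kf lam).

Lemma nvalP (A A' : 'rV[R]_#|Nd|) : (forall v, nval A v = nval A' v) -> A = A'.
Proof.
by move=> H; apply/rowP => i; have := H (enum_val i); rewrite /nval enum_valK.
Qed.

Lemma nval_row (f : Nd -> R) v : nval (\row_i f (enum_val i)) v = f v.
Proof. by rewrite /nval mxE enum_rankK. Qed.

Lemma tree_sol_ker c y y1 : tree_sol lam (kf lam) c y y1 ->
  (\row_i node_val c y (enum_val i)) *m B = 0.
Proof.
move=> ts; apply: nvalP => v; rewrite robin_kerE nval_row.
rewrite (ME lamP (tree_sol_piece_sol ts)) => [|p s]; last by rewrite nval_row (tree_sol_node ts).
by rewrite [RHS]mxE; exact: tree_sol_kirchhoff ts v.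
Qed.

Lemma tree_sol_zero c y y1 : tree_sol lam (kf lam) c y y1 -> (forall v, node_val c y v = 0) ->
  forall j x, 0 <= x <= l -> y j x = 0.
Proof.
move=> ts z; apply: grid_zero => p x xp.
have node0 s := etrans (tree_sol_node ts p s) (z _).
have [u0 _] := piece_sol_unique h_gt0 hK beE piece_pot_intg piece_pot_K lamP (tree_sol_piece_sol ts p)
  (node0 false) (node0 true).
exact: u0.
Qed.

(** Solve on each piece with the given node values. At an inner cut the kernel
    equation says that the two derivatives agree, so the pieces of an edge can be
    glued. At a vertex it is the vertex condition. *)
Lemma ker_tree_sol (C : 'rV[R]_#|Nd|) : C *m B = 0 ->
  exists y y1, tree_sol lam (kf lam) (fun v => nval C (inl v : Nd)) y y1 /\
    forall v, node_val (fun v => nval C (inl v : Nd)) y v = nval C v.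
Proof.
move=> CB.
have [U [Us Uc]] := family_exists (@piece_end T N') h_gt0 hK beE piece_pot_intg piece_pot_K C lamP.
have kir v : \sum_p \sum_(s | piece_end p s == v) flux al be p s (U p).2 +
    (v == root_node)%:R * (kf lam * nval C root_node) = 0.
  rewrite -(ME lamP Us Uc) -robin_kerE CB; exact: mxE.
have edgeW e : exists w : (R -> R) * (R -> R), [/\
    sol (fun t => q e t - lam) 0 l w.1 w.2,
    w.1 0 = nval C (inl (tinit e) : Nd) /\ w.1 l = nval C (inl (tterm e) : Nd),
    forall j : 'I_N', w.1 (grid j.+1) = nval C (inr (e, j) : Nd),
    w.2 0 = (U (e, ord0)).2 (al (e, ord0)) &
    w.2 l = (U (e, ord_max)).2 (be (e, ord_max))].
  pose u (i : nat) := (U (e, inord i)).1; pose u1 (i : nat) := (U (e, inord i)).2.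
  have lmax (j : 'I_N') : inord j = lift ord_max j :> 'I_N.
    apply: val_inj; rewrite /= inordK; last by rewrite ltnS ltnW// ltn_ord.
    by rewrite /bump leqNgt ltn_ord.
  have l0' (j : 'I_N') : inord j.+1 = lift ord0 j :> 'I_N.
    by apply: val_inj; rewrite /= inordK// ltnS ltn_ord.
  have uR (j : 'I_N') : u j (grid j.+1) = nval C (inr (e, j) : Nd).
    have := Uc (e, lift ord_max j) true; rewrite piece_end_lift_max /pt/be/=.
    by rewrite /u lmax /bump leqNgt ltn_ord.
  have uL (j : 'I_N') : u j.+1 (grid j.+1) = nval C (inr (e, j) : Nd).
    have := Uc (e, lift ord0 j) false; rewrite piece_end_lift0 /pt/al/=.
    by rewrite /u l0'.
  have o0 : inord 0 = ord0 :> 'I_N by apply: val_inj; rewrite /= inordK.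
  have om : inord N' = ord_max :> 'I_N by apply: val_inj; rewrite /= inordK.
  have [||i iN|i iN|w [w1 [ws w0 wi w10 w1m]]] :=
      @glue_seq R (fun t => q e t - lam) grid u u1 N'.
  - by move=> i; exact: grid_le.
  - by rewrite grid0 gridN; apply: intgB => //; exact: intg_cst.
  - by have := Us (e, inord i); rewrite /piece_sol /al /be/= inordK.
  - pose j := Ordinal iN; rewrite (uR j) (uL j); split=> //.
    have := kir (inr (e, j) : Nd); rewrite sum_pend_inr /flux/= mul0r addr0.
    rewrite /al /be/= /bump leqNgt iN add0n leq0n add1n -lmax -l0' /=.
    by rewrite mul1r mulN1r => /eqP; rewrite subr_eq0 => /eqP.
  exists (w, w1); rewrite grid0 gridN /= in ws w0 w10 w1m *; split => //.
  - split.
      by rewrite w0 /u o0; have := Uc (e, ord0) false; rewrite piece_end0 /pt/al/= grid0.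
    rewrite -[in LHS]gridN wi// /u om; have := Uc (e, ord_max) true.
    by rewrite piece_end_max /pt/be/=.
  - by move=> j; rewrite wi ?uR// ltnW.
  - by rewrite w10 /u1 o0 /al/= grid0.
  - by rewrite w1m /u1 om /be/= gridN.
have [W WE] := choice edgeW.
exists (fun e => (W e).1), (fun e => (W e).2); split; last first.
  by case=> [//|[e j]] /=; have [_ _ -> _ _] := WE e.
split=> [e|e|v]; [by have [] := WE e|by have [] := WE e|].
have H := kir (inl v); rewrite sum_pend_inl in H.
rewrite -[RHS]H; congr (_ + _); congr (_ + _).
  by apply: eq_bigr => e _; have [_ _ _ _ ->] := WE e; rewrite /flux/= mul1r.
rewrite -sumrN; apply: eq_bigr => e _; have [_ _ _ -> _] := WE e.
by rewrite /flux/= mulN1r.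
Qed.

End kernel.
End tree_solutions.

(** * Sobolev functions and the lead *)

Section sobolev_solutions.
Context {R : realType}.
Implicit Types (a b c k x y X : R) (f g u q : R -> R).
Local Notation mu := (@lebesgue_measure R).

Lemma L2_sub (D D' : set R) f : measurable D -> measurable D' -> D' `<=` D ->
  L2 D f -> L2 D' f.
Proof.
move=> mD mD' DD [mf fi]; split; first exact: measurable_funS mf.
exact: integrableS fi.
Qed.

Lemma L2_intg a b f : L2 `[a, b] f -> intg a b f.
Proof.
move=> [mf fi].
have gi : intg a b (fun x => 1 + f x ^+ 2).
  by apply: intgD => //; exact: intg_cst.
apply: le_integrable gi => //; first exact/measurable_EFinP.
move=> x _; rewrite /= lee_fin [leRHS]ger0_norm ?addr_ge0 ?sqr_ge0//.
rewrite -[f x ^+ 2]real_normK ?num_real//.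
have := sqr_ge0 (`|f x| - 1); have := normr_ge0 (f x); nra.
Qed.

Lemma L2_bmf a b f : bmf a b f -> L2 `[a, b] f.
Proof. by move=> bf; split; [case: bf|exact: intg_sqr]. Qed.

Lemma intg_meas a b f : intg a b f -> measurable_fun `[a, b] f.
Proof. by move=> /measurable_int /measurable_EFinP. Qed.

Lemma ae_itg a b f g : intg a b f -> intg a b g ->
  {ae mu, forall x, `[a, b]%classic x -> f x = g x} -> itg a b f = itg a b g.
Proof.
move=> fi gi fg; rewrite /itg /Rintegral; congr fine.
have mf := intg_meas fi; have mg := intg_meas gi.
apply: ae_eq_integral; [by []|exact/measurable_EFinP|exact/measurable_EFinP|].
exact: (@ae_imp R _ (fun x => `[a, b]%classic x -> (f x)%:E = (g x)%:E) fg
  (fun x H Dx => congr1 EFin (H Dx))).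
Qed.

Lemma H2_sol (D : set R) b Q u u1 u2 : measurable D -> 0 <= b -> `[0, b] `<=` D ->
  intg 0 b Q -> H2_real D u u1 u2 ->
  {ae mu, forall x, D x -> u2 x = Q x * u x} ->
  sol Q 0 b u u1.
Proof.
move=> mD b0 bD Qi [Lu Lu1 Lu2 uE] u2E.
have u1i : intg 0 b u1 by apply: L2_intg; exact: L2_sub Lu1.
have u2i : intg 0 b u2 by apply: L2_intg; exact: L2_sub Lu2.
have uP : prim 0 b u u1.
  by move=> x xb; have [] := uE x; first by apply: bD; rewrite /= in_itv.
have u1P : prim 0 b u1 u2.
  by move=> x xb; have [] := uE x; first by apply: bD; rewrite /= in_itv.
have bu := prim_bmf b0 u1i uP; have bu1 := prim_bmf b0 u2i u1P.
split=> // x /andP[x0 xb]; rewrite u1P ?x0//; congr (_ + _).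
apply: ae_itg.
- exact: intg_sub xb u2i.
- exact: intg_sub xb (intgM Qi bu).
- apply: (ae_imp u2E) => t + tx; apply; apply: bD; move: tx.
  by rewrite /= !in_itv/= => /andP[-> tx]; exact: le_trans xb.
Qed.

Lemma L2_ql a b q lam u : L2 `[a, b] q -> bmf a b u ->
  L2 `[a, b] (fun t => (q t - lam) * u t).
Proof.
move=> Lq bu; have qi := L2_intg Lq.
have Qi : intg a b (fun t => q t - lam) by apply: intgB => //; exact: intg_cst.
split; first by apply: intg_meas; exact: intgM.
suff : intg a b (fun t => (q t ^+ 2 - (2 * lam * q t - lam ^+ 2)) * (u t * u t)).
  by apply: eq_intg => x _; ring.
apply: intgM; last exact: bmfM.
by apply: intgB; [case: Lq|apply: intgB; [exact: intgZ|exact: intg_cst]].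
Qed.

Lemma sol_H2 b q lam u u1 : L2 `[0, b] q -> sol (fun t => q t - lam) 0 b u u1 ->
  H2_real `[0, b] u u1 (fun t => (q t - lam) * u t).
Proof.
move=> Lq [bu bu1 uE u1E]; split.
- exact: L2_bmf.
- exact: L2_bmf.
- exact: L2_ql.
- by move=> x; rewrite /= in_itv/= => xb; split; [exact: uE|exact: u1E].
Qed.

Lemma H2_real0 (D : set R) : measurable D -> H2_real D (fun=> 0) (fun=> 0) (fun=> 0).
Proof.
move=> mD; have L0 : L2 D (fun=> 0 : R).
  split; first exact: measurable_cst.
  by rewrite expr0n; exact: integrable0.
split=> // x _; rewrite (_ : \int[_]_(t in _) 0 = 0) ?addr0//.
by rewrite /Rintegral integral0.
Qed.

Lemma expRM_cont c : continuous (fun x => expR (c * x)).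
Proof.
move=> x; apply: continuous_comp; last exact: continuous_expR.
exact: mulrl_continuous.
Qed.

Lemma bmf_expR c a b : bmf a b (fun x => expR (c * x)).
Proof. by apply/bmf_cont/continuous_subspaceT; exact: expRM_cont. Qed.

Lemma prim_expR c X : prim 0 X (fun x => expR (c * x)) (fun x => c * expR (c * x)).
Proof.
move=> x /andP[x0 xX]; have [x00|x_gt0] := leP x 0.
  by have -> : x = 0 by [apply/eqP; rewrite eq_le x00]; rewrite itgxx addr0.
rewrite /itg /Rintegral (@continuous_FTC2 _ _ (fun x => expR (c * x)) 0 x)//=.
- by ring.
- apply: continuous_subspaceT => z.
  by apply: cvgM; [exact: cvg_cst|exact: expRM_cont].
- split.
  + by move=> z _; exact: ex_derive.
  + by apply/cvg_at_right_filter; exact: expRM_cont.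
  + by apply/cvg_at_left_filter; exact: expRM_cont.
- move=> z _; rewrite derive1_comp// derive1E.
  have /funeqP -> := @derive_expR R.
  by rewrite derive1Ml// derive1_id mulr1 mulrC.
Qed.

(** Integrate by parts [p] against [exp (- c x)]: the integrand is zero. *)
Lemma exp_flow c X p : 0 <= X -> bmf 0 X p -> prim 0 X p (fun t => c * p t) ->
  p X = p 0 * expR (c * X).
Proof.
move=> X0 bp pE.
have := int_by_parts X0 (intg_bmf (bmfZ c bp)) (bmfZ (- c) (bmf_expR (- c) 0 X)) pE (@prim_expR (- c) X).
rewrite -itgD; last 2 first.
- by apply: intg_bmf; apply: bmfM; [exact: bmfZ|exact: bmf_expR].
- by apply: intg_bmf; apply: bmfM => //; apply: bmfZ; exact: bmf_expR.
rewrite (@eq_itg _ _ _ _ (fun=> 0)) => [|x _]; last by ring.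
rewrite itg_cst// mul0r mulr0 expR0 mulr1 => /eqP; rewrite subr_eq0 => /eqP pX.
by rewrite -pX -mulrA -expRD mulNr addNr expR0 mulr1.
Qed.

Lemma itg_le_itvy X g : 0 <= X -> mu.-integrable `[0, +oo[ (EFin \o g) ->
  (forall x, 0 <= x -> 0 <= g x) ->
  itg 0 X g <= \int[mu]_(x in `[0, +oo[) g x.
Proof.
move=> X0 gi g0; rewrite /itg /Rintegral; apply: fine_le.
- apply: integrable_fin_num => //; apply: integrableS gi => //.
  exact: subset_itvl.
- exact: integrable_fin_num.
apply: ge0_subset_integral => //.
- exact: measurable_int gi.
- by move=> x; rewrite /= in_itv/= andbT lee_fin; exact: g0.
- exact: subset_itvl.
Qed.

(** [p = u1 + k u] satisfies [p' = k p], so [|p|] is at least [|p 0|] on the whole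
    half-line. As [p] is square integrable, it is zero, and [u' = - k u] follows. *)
Lemma lead_exp k u u1 u2 : 0 < k -> H2_real `[0, +oo[ u u1 u2 ->
  {ae mu, forall x, `[0, +oo[%classic x -> u2 x = k ^+ 2 * u x} ->
  (forall x, 0 <= x -> u x = u 0 * expR (- k * x)) /\ u1 0 = - k * u 0.
Proof.
move=> k0 H2u u2E; have [[mu0 Lu] [mu1 Lu1] _ _] := H2u.
have us X : 0 <= X -> sol (fun=> k ^+ 2) 0 X u u1.
  move=> X0; apply: H2_sol H2u u2E => //; first exact: subset_itvl.
  exact: intg_cst.
pose p x := u1 x + k * u x.
have pexp X : 0 <= X -> p X = p 0 * expR (k * X).
  move=> X0; have [bu bu1 uE u1E] := us X X0.
  apply: exp_flow => //; first by apply: bmfD => //; exact: bmfZ.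
  have := primD (intg_bmf (bmfZ (k ^+ 2) bu)) (intg_bmf (bmfZ k bu1)) u1E (primZ k (intg_bmf bu1) uE).
  by apply: eq_prim => x _; rewrite /p; ring.
have p0 : p 0 = 0.
  pose g x := 2 * u1 x ^+ 2 + 2 * k ^+ 2 * u x ^+ 2.
  have gi : mu.-integrable `[0, +oo[ (EFin \o g).
    have := integrableD _ (integrableZl _ 2 Lu1) (integrableZl _ (2 * k ^+ 2) Lu).
    by apply.
  have g0 x : 0 <= x -> 0 <= g x.
    by move=> _; have := sqr_ge0 (u1 x); have := mulr_ge0 (sqr_ge0 k) (sqr_ge0 (u x)); rewrite /g; lra.
  set S := \int[mu]_(x in `[0, +oo[) g x.
  have bound X : 0 <= X -> p 0 ^+ 2 * X <= S.
    move=> X0; have [bu bu1 uE u1E] := us X X0.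
    apply: le_trans (itg_le_itvy X0 gi g0).
    have -> : p 0 ^+ 2 * X = itg 0 X (fun=> p 0 ^+ 2) by rewrite itg_cst// subr0.
    apply: le_itg; first exact: intg_cst.
      by apply: integrableS gi => //; exact: subset_itvl.
    move=> x /andP[x0 xX].
    apply: (@le_trans _ _ (p x ^+ 2)).
      rewrite (pexp x x0) exprMn ler_peMr ?sqr_ge0// expr_ge1//.
      by rewrite -expR0 ler_expR mulr_ge0// ltW.
    by rewrite /p /g; have := sqr_ge0 (u1 x - k * u x); nra.
  apply/eqP; rewrite -sqrf_eq0 eq_le sqr_ge0 andbT leNgt; apply/negP => p2.
  have S0 : 0 <= S by have := bound 0 (lexx _); rewrite mulr0.
  have X0 : 0 <= (S + 1) / p 0 ^+ 2 by apply: divr_ge0; [lra|exact: ltW].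
  have := bound _ X0; rewrite mulrCA divff ?mulr1; last by rewrite gt_eqF.
  lra.
have u1u x : 0 <= x -> u1 x = - k * u x.
  by move=> /pexp; rewrite p0 mul0r /p; lra.
split; last exact: u1u.
move=> X X0; have [bu bu1 uE u1E] := us X X0.
apply: exp_flow => //; apply: eq_prim uE => x /andP[x0 _]; exact: u1u.
Qed.

Lemma lead_H2 k A : 0 < k ->
  H2_real `[0, +oo[ (fun x => A * expR (- k * x))
    (fun x => - k * (A * expR (- k * x))) (fun x => k ^+ 2 * (A * expR (- k * x))).
Proof.
move=> k0.
have L C : L2 `[0, +oo[ (fun x => C * expR (- k * x)).
  have k2 : 0 < 2 * k by rewrite mulr_gt0.
  split.
    apply: measurable_funTS; apply: continuous_measurable_fun => x.
    by apply: cvgM; [exact: cvg_cst|exact: expRM_cont].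
  have Ei : mu.-integrable `[0, +oo[ (EFin \o exponential_pdf (2 * k)).
    by apply: integrableS (integrable_exponential_pdf k2).
  have := integrableZl _ (C ^+ 2 / (2 * k)) Ei => H.
  have := H (measurable_itv _); apply: eq_integrable => // x.
  rewrite inE/= in_itv/= andbT => x0; rewrite exponential_pdfE//.
  rewrite -EFinM; congr (_%:E).
  have -> : - (2 * k) * x = - k * x + - k * x by ring.
  by rewrite expRD; field; rewrite gt_eqF.
have P X : prim 0 X (fun x => A * expR (- k * x)) (fun x => - k * (A * expR (- k * x))).
  have := primZ A (intg_bmf (bmfZ (- k) (bmf_expR (- k) 0 X))) (@prim_expR (- k) X).
  by apply: eq_prim => x _; ring.
split.
- exact: L.
- rewrite (_ : (fun x => _) = (fun x => (- k * A) * expR (- k * x))); first exact: L.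
  by apply/funext => x; rewrite mulrA.
- rewrite (_ : (fun x => _) = (fun x => (k ^+ 2 * A) * expR (- k * x))); first exact: L.
  by apply/funext => x; rewrite mulrA.
- move=> x; rewrite /= in_itv/= andbT => x0; have xx : 0 <= x <= x by rewrite x0 lexx.
  split; first exact: P xx.
  have bA : bmf 0 x (fun x => - k * (A * expR (- k * x))).
    by apply/bmfZ/bmfZ; exact: bmf_expR.
  have := primZ (- k) (intg_bmf bA) (P x) xx => ->; congr (_ + _).
  by apply: eq_itg => t _; ring.
Qed.

End sobolev_solutions.

(** * Vertex conditions *)

Section vertex_conditions.
Local Open Scope complex_scope.
Context {R : realType} (T : rooted_tree) (l : R) (q : edge T -> R -> R).
Hypotheses (l0 : 0 < l) (hq : forall j, L2 `[0, l] (q j)).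
Variables (e0 : edge T) (N' : nat).
Hypothesis e0r : tinit e0 = root T.
Local Notation Nd := (node T N').

Lemma pot_intg j : intg 0 l (q j). Proof. exact/L2_intg. Qed.

(** A point of the tree at each node: the end of the incoming edge if the node is a
    vertex other than the root, and the start of the outgoing edge [e0] at the
    root. Reading off node values at these points makes them linear in the family,
    without reference to continuity. *)
Definition node_point (v : Nd) : edge T * R :=
  match v with
  | inl v => if [pick j | tterm j == v] is Some j then (j, l) else (e0, 0)
  | inr (e, j) => (e, grid l N' j.+1)
  end.

Lemma node_point_in v : 0 <= (node_point v).2 <= l.
Proof.
case: v => [v|[e j]] /=; first by case: pickP => [j|] _ /=; rewrite ?lexx ?ltW.
apply/andP; split; first by rewrite -[leLHS](grid0 l N') grid_le.
by rewrite -[leRHS](gridN l N') grid_le// ltnS ltnW.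
Qed.

Lemma node_point_root : node_point (inl (root T)) = (e0, 0).
Proof.
rewrite /=; case: pickP => [j /eqP jr|//].
by have [_ /(_ j)] := incoming_edge T; rewrite jr eqxx.
Qed.

Lemma node_point_tterm j : node_point (inl (tterm j)) = (j, l).
Proof.
rewrite /=; case: pickP => [k /eqP kj|/(_ j)]; last by rewrite eqxx.
by have [inj _ _] := incoming_edge T; rewrite (inj _ _ kj).
Qed.

Lemma node_point_node lam kap c y y1 v : tree_sol l q lam kap c y y1 ->
  node_val l c y v = y (node_point v).1 (node_point v).2.
Proof.
move=> [_ yc _]; case: v => [v|[e j]] //=; case: pickP => [j /eqP <-|nv] /=.
  by have [] := yc j.
have -> : v = root T.
  apply/eqP/negPn/negP => vr; have [_ _ /(_ v vr)[e ev]] := incoming_edge T.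
  by have := nv e; rewrite ev eqxx.
by have [-> _] := yc e0; rewrite e0r.
Qed.

Lemma std_tree_sol lam kap (y y1 : edge T -> R -> R) :
  (forall j, sol (fun t => q j t - lam) 0 l (y j) (y1 j)) ->
  (forall j k, tinit k = tterm j -> y j l = y k 0) ->
  (forall j, y1 j l = \sum_(k | tinit k == tterm j) y1 k 0) ->
  (forall j k, tinit j = root T -> tinit k = root T -> y j 0 = y k 0) ->
  \sum_(k | tinit k == root T) y1 k 0 = kap * y e0 0 ->
  tree_sol l q lam kap (fun v => y (node_point (inl v)).1 (node_point (inl v)).2) y y1.
Proof.
move=> ys yc yk rc rk; have [tinj troot tex] := incoming_edge T.
split=> // [j|v].
  rewrite node_point_tterm; split=> //; have [jr|jr] := eqVneq (tinit j) (root T).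
    by rewrite jr node_point_root; exact: rc.
  by have [k kj] := tex _ jr; rewrite -kj node_point_tterm (yc k j).
rewrite node_point_root; have [->|vr] := eqVneq v (root T).
  rewrite big_pred0 => [|j]; last exact: negPf (troot j).
  by rewrite rk mul1r; ring.
have [j <-] := tex v vr; rewrite mul0r addr0.
rewrite (big_pred1 j) => [|k]; last by rewrite (inj_eq tinj).
by rewrite yk subrr.
Qed.

Lemma tree_sol_std lam kap c (y y1 : edge T -> R -> R) : tree_sol l q lam kap c y y1 ->
  [/\ forall j k, tinit k = tterm j -> y j l = y k 0,
      forall j, y1 j l = \sum_(k | tinit k == tterm j) y1 k 0,
      forall k, tinit k = root T -> y k 0 = c (root T) &
      \sum_(k | tinit k == root T) y1 k 0 = kap * c (root T)].
Proof.
move=> [_ yc yk]; have [tinj troot _] := incoming_edge T; split.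
- by move=> j k kj; have [_ ->] := yc j; have [-> _] := yc k; rewrite kj.
- move=> j; have := yk (tterm j); rewrite (negPf (troot j)) mul0r addr0.
  rewrite (big_pred1 j) => [|k]; last by rewrite (inj_eq tinj).
  by move=> /eqP; rewrite subr_eq0 => /eqP.
- by move=> k kr; have [-> _] := yc k; rewrite kr.
- have := yk (root T); rewrite eqxx mul1r big_pred0 => [|j].
    lra.
  exact: negPf (troot j).
Qed.

(** The real part and the imaginary part are treated at once, as additive maps that
    are compatible with multiplication by reals. *)

Section projection.
Variable pr : {additive R[i] -> R}.
Hypothesis prZ : forall (a : R) z, pr (a%:C * z) = a * pr z.

Lemma pr_sol lam D (b : R) (f f1 f2 : R -> R[i]) (g : R -> R) :
  measurable D -> 0 <= b -> `[0, b] `<=` D -> intg 0 b g ->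
  H2_real D (pr \o f) (pr \o f1) (pr \o f2) ->
  {ae (@lebesgue_measure R), forall x, D x -> lam%:C * f x = - f2 x + (g x)%:C * f x} ->
  sol (fun t => g t - lam) 0 b (pr \o f) (pr \o f1) /\
  {ae (@lebesgue_measure R), forall x, D x -> pr (f2 x) = (g x - lam) * pr (f x)}.
Proof.
move=> mD b0 bD gi H2f ae.
have ae' : {ae (@lebesgue_measure R), forall x, D x -> pr (f2 x) = (g x - lam) * pr (f x)}.
  apply: (ae_imp ae) => x + Dx => /(_ Dx) /(congr1 pr).
  by rewrite prZ raddfD raddfN prZ /=; lra.
split=> //; apply: (H2_sol mD b0 bD _ H2f ae').
by apply: intgB => //; exact: intg_cst.
Qed.

Lemma pr_N lam (y y1 y2 : edge T -> R -> R[i]) :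
  (forall j, H2_real `[0, l] (pr \o y j) (pr \o y1 j) (pr \o y2 j)) ->
  bc_N l y y1 ->
  (forall j, {ae (@lebesgue_measure R), forall x, `[0, l]%classic x ->
     lam%:C * y j x = - y2 j x + (q j x)%:C * y j x}) ->
  exists c f1, tree_sol l q lam 0 c (fun j x => pr (y j x)) f1.
Proof.
move=> yH [[yc yk] rc rk] ae.
exists (fun v => pr (y (node_point (inl v)).1 (node_point (inl v)).2)), (fun j x => pr (y1 j x)).
apply: (@std_tree_sol lam 0 (fun j x => pr (y j x))).
- move=> j; have [||] := pr_sol _ (ltW l0) _ (pot_intg j) (yH j) (ae j) => //.
- by move=> j k jk; rewrite (yc j k).
- by move=> j; rewrite yk raddf_sum.
- by move=> j k jr kr; rewrite (rc j k).
- by rewrite -raddf_sum rk raddf0 mul0r.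
Qed.

(** The decay on the lead gives [y' = - sqrt (- lam) y] at its start, so the vertex
    condition at the root becomes a Robin condition for the tree alone. *)
Lemma pr_oo lam (y y1 y2 : option (edge T) -> R -> R[i]) : lam < 0 ->
  (forall j, H2_real (dom_oo l j) (pr \o y j) (pr \o y1 j) (pr \o y2 j)) ->
  bc_oo l y y1 ->
  (forall j, {ae (@lebesgue_measure R), forall x, dom_oo l j x ->
     lam%:C * y j x = - y2 j x + (q_oo q j x)%:C * y j x}) ->
  exists c f1, tree_sol l q lam (Num.sqrt (- lam)) c (fun j x => pr (y (Some j) x)) f1 /\
    forall x, 0 <= x -> pr (y None x) = c (root T) * expR (- Num.sqrt (- lam) * x).
Proof.
move=> lam0 yH [[yc yk] rc rk] ae.
set k := Num.sqrt (- lam).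
have k0 : 0 < k by rewrite sqrtr_gt0 oppr_gt0.
have k2 : k ^+ 2 = - lam by rewrite sqr_sqrtr// oppr_ge0 ltW.
have [lead lead1] : (forall x, 0 <= x -> pr (y None x) = pr (y None 0) * expR (- k * x))
    /\ pr (y1 None 0) = - k * pr (y None 0).
  apply: (lead_exp k0 (yH None)).
  have [||| _ H] := pr_sol _ (lexx 0) _ _ (yH None) (ae None) => //=.
  - exact: subset_itvl.
  - exact: intg_cst.
  - by apply: (ae_imp H) => x + Dx => /(_ Dx) /= ->; rewrite k2 sub0r.
exists (fun v => pr (y (Some (node_point (inl v)).1) (node_point (inl v)).2)),
  (fun j x => pr (y1 (Some j) x)).
split; last first.
  by move=> x x0; rewrite lead// node_point_root/= (rc e0).
apply: (@std_tree_sol lam k (fun j x => pr (y (Some j) x))).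
- move=> j; have [//|//|] := @pr_sol lam `[0, l]%classic l _ _ _ (q j)
    _ (ltW l0) _ (pot_intg j) (yH (Some j)) (ae (Some j)).
  by [].
- by move=> j i ji; rewrite (yc j i).
- by move=> j; rewrite yk raddf_sum.
- by move=> i j' ir jr; rewrite -(rc i ir) -(rc j' jr).
- move/(congr1 pr)/eqP: rk; rewrite raddfD raddf0 addr_eq0 lead1 raddf_sum (rc e0)//.
  by rewrite mulNr => /eqP /oppr_inj <-.
Qed.

End projection.

End vertex_conditions.

(** * Counting the negative eigenvalues *)

Lemma eq_H2_real (R : realType) (D : set R) (u u' u1 u2 : R -> R) : measurable D ->
  D 0 -> (forall x, D x -> u' x = u x) -> H2_real D u u1 u2 -> H2_real D u' u1 u2.
Proof.
move=> mD D0 uu' [[mu Lu] Lu1 Lu2 uE]; split=> // [|x Dx].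
  split; first by apply: eq_measurable_fun mu => x; rewrite inE => /uu' ->.
  by apply: eq_integrable Lu => // x; rewrite inE => /uu' ->.
by rewrite !uu'//; exact: uE.
Qed.

Section eigenfunctions.
Local Open Scope complex_scope.
Context {R : realType} (T : rooted_tree) (l : R) (q : edge T -> R -> R).
Hypotheses (l0 : 0 < l) (hq : forall j, L2 `[0, l] (q j)).

Lemma tree_sol_H2 lam kap c f f1 j : tree_sol l q lam kap c f f1 ->
  H2 `[0, l] (fun x => (f j x)%:C) (fun x => (f1 j x)%:C)
    (fun x => ((q j x - lam) * f j x)%:C).
Proof.
move=> [fs _ _]; split; last exact: H2_real0.
exact: (sol_H2 (hq j) (fs j)).
Qed.

Lemma eigen_eq lam (a x y : R) : lam%:C * x%:C = - ((a - lam) * x)%:C + a%:C * x%:C.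
Proof. by rewrite -!rmorphM -rmorphN -rmorphD; congr (_%:C); ring. Qed.

Lemma eigenspace_N lam c f f1 : tree_sol l q lam 0 c f f1 ->
  eigenspace (L_N l q) lam (fun j x => (f j x)%:C).
Proof.
move=> ts; have [yc yk rc rk] := tree_sol_std ts.
exists (fun j x => (f1 j x)%:C), (fun j x => ((q j x - lam) * f j x)%:C); split.
- by move=> j; exact: tree_sol_H2 ts.
- split.
  + split=> [j k jk|j]; first by rewrite (yc j k).
    by rewrite yk rmorph_sum.
  + by move=> j k jr kr; rewrite !rc.
  + by rewrite -rmorph_sum rk mul0r.
- by move=> j; apply: aeW => x _; exact: eigen_eq.
Qed.

Lemma eigenspace_oo lam c (F : option (edge T) -> R -> R) f1 : lam < 0 ->
  tree_sol l q lam (Num.sqrt (- lam)) c (fun j => F (Some j)) f1 ->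
  (forall x, 0 <= x -> F None x = c (root T) * expR (- Num.sqrt (- lam) * x)) ->
  eigenspace (L_oo l q) lam (fun j x => (F j x)%:C).
Proof.
move=> lam0 ts; set k := Num.sqrt (- lam) => FN.
have k0 : 0 < k by rewrite sqrtr_gt0 oppr_gt0.
have k2 : k ^+ 2 = - lam by rewrite sqr_sqrtr// oppr_ge0 ltW.
have F0 : F None 0 = c (root T) by rewrite FN// mulr0 expR0 mulr1.
have [yc yk rc rk] := tree_sol_std ts.
pose G x := c (root T) * expR (- k * x).
exists (fun j x => (if j is Some j then f1 j x else - k * G x)%:C),
  (fun j x => (if j is Some j then (q j x - lam) * F (Some j) x else k ^+ 2 * G x)%:C).
split.
- case=> [j|]; first exact: tree_sol_H2 ts.
  split; last by apply: H2_real0; exact: measurable_itv.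
  apply: (eq_H2_real _ _ _ (lead_H2 (c (root T)) k0)) => //.
    by rewrite /= in_itv/= lexx.
  by move=> x; rewrite /= in_itv/= andbT => /FN.
- split.
  + split=> [j i ji|j]; first by rewrite (yc j i).
    by rewrite yk rmorph_sum.
  + by move=> i ir; rewrite F0 rc.
  + rewrite -rmorph_sum rk /G mulr0 expR0 mulr1 -rmorphD.
    by rewrite mulNr addNr.
- case=> [j|]; apply: aeW => x; first by move=> _; exact: eigen_eq.
  rewrite /= in_itv/= andbT => /FN ->; rewrite -/(G x).
  by rewrite k2 -!rmorphM -rmorphN -rmorphD; congr (_%:C); ring.
Qed.

Lemma tree_sol_ae0 lam kap c f f1 : tree_sol l q lam kap c f f1 ->
  (forall j, {ae (@lebesgue_measure R), forall x, `[0, l]%classic x -> f j x = 0}) ->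
  forall j x, 0 <= x <= l -> f j x = 0.
Proof.
move=> [fs _ _] ae j; have [bu bu1 uE _] := fs j.
apply: (itg_sqr_eq0 l0 uE bu1).
rewrite (@ae_itg _ _ _ _ (fun=> 0)).
- by rewrite itg_cst ?mul0r// ltW.
- exact: intg_sqr.
- exact: intg_cst.
- by apply: (ae_imp (ae j)) => x H Dx; rewrite H// expr0n.
Qed.

Variables (e0 : edge T) (N' : nat) (K : R).
Local Notation h := (l / N'.+1%:R).
Hypotheses (e0r : tinit e0 = root T) (K0 : 0 < K) (hK : h * K <= 20^-1)
  (qK : forall j, itg 0 l (fun t => `|q j t|) <= K).
Local Notation Nd := (node T N').
Local Notation alp := (@al R T l N').
Local Notation bep := (@be R T l N').
Local Notation qpp := (@piece_pot R T q N').
Variable M : R -> 'M[R]_#|Nd|.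
Hypothesis ME : forall lam, - lam0 h K <= lam <= 0 ->
  forall (c : 'rV_#|Nd|) (u u1 : piece T N' -> R -> R),
    (forall p, piece_sol alp bep qpp p lam (u p) (u1 p)) ->
    (forall p s, u p (pt alp bep p s) = nval c (piece_end p s)) ->
  forall v, nval (c *m M lam) v =
    \sum_p \sum_(s : bool | piece_end p s == v) flux alp bep p s (u1 p).
Local Notation rn := (inl (root T) : Nd).
Let qi j : intg 0 l (q j). Proof. exact: pot_intg. Qed.
Let ev (i : 'I_#|Nd|) : edge T * R := node_point l e0 (enum_val i).
Local Notation Re := (@complex.Re R : {additive R[i] -> R}).
Local Notation Im := (@complex.Im R : {additive R[i] -> R}).

Let ReZ (a : R) (z : R[i]) : Re (a%:C * z) = a * Re z.
Proof. by case: z => x y /=; rewrite mul0r subr0. Qed.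
Let ImZ (a : R) (z : R[i]) : Im (a%:C * z) = a * Im z.
Proof. by case: z => x y /=; rewrite mul0r addr0. Qed.

Definition eig_real_N lam : set (edge T -> R -> R) :=
  [set f | exists c f1, tree_sol l q lam 0 c f f1].

Definition eig_real_oo lam : set (option (edge T) -> R -> R) :=
  [set f | exists c f1, tree_sol l q lam (Num.sqrt (- lam)) c (fun j => f (Some j)) f1 /\
    forall x, 0 <= x -> f None x = c (root T) * expR (- Num.sqrt (- lam) * x)].

Lemma eig_real_N_lin lam k f g : eig_real_N lam f -> eig_real_N lam g ->
  eig_real_N lam (fun j x => k * f j x + g j x).
Proof.
move=> [c [f1 fs]] [d [g1 gs]].
by exists (fun v => k * c v + d v), (fun j x => k * f1 j x + g1 j x); exact: tree_sol_lin.
Qed.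

Lemma eig_real_N0 lam : eig_real_N lam (fun _ _ => 0).
Proof. by exists (fun=> 0), (fun _ _ => 0); exact: tree_sol0. Qed.

Lemma eig_real_oo_lin lam k f g : eig_real_oo lam f -> eig_real_oo lam g ->
  eig_real_oo lam (fun j x => k * f j x + g j x).
Proof.
move=> [c [f1 [fs fN]]] [d [g1 [gs gN]]].
exists (fun v => k * c v + d v), (fun j x => k * f1 j x + g1 j x).
split; first exact: tree_sol_lin.
by move=> x x0; rewrite fN// gN//; ring.
Qed.

Lemma eig_real_oo0 lam : eig_real_oo lam (fun _ _ => 0).
Proof.
exists (fun=> 0), (fun _ _ => 0); split; first exact: tree_sol0.
by move=> x _; rewrite mul0r.
Qed.

Lemma eigenspace_N_S lam y : eigenspace (L_N l q) lam y ->
  eig_real_N lam (fun j x => Re (y j x)) /\ eig_real_N lam (fun j x => Im (y j x)).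
Proof.
move=> [y1 [y2 [yH bc ae]]]; split.
  by apply: (pr_N l0 hq N' e0r ReZ _ bc ae) => j; case: (yH j).
by apply: (pr_N l0 hq N' e0r ImZ _ bc ae) => j; case: (yH j).
Qed.

Lemma eigenspace_oo_S lam y : lam < 0 -> eigenspace (L_oo l q) lam y ->
  eig_real_oo lam (fun j x => Re (y j x)) /\ eig_real_oo lam (fun j x => Im (y j x)).
Proof.
move=> lam_lt [y1 [y2 [yH bc ae]]]; split.
  by apply: (pr_oo l0 hq N' e0r ReZ lam_lt _ bc ae) => j; case: (yH j).
by apply: (pr_oo l0 hq N' e0r ImZ lam_lt _ bc ae) => j; case: (yH j).
Qed.

Lemma row_node_val (f : edge T -> R -> R) c lam kap f1 : tree_sol l q lam kap c f f1 ->
  \row_v f (ev v).1 (ev v).2 = \row_i node_val l c f (enum_val i).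
Proof. by move=> ts; apply/rowP => i; rewrite !mxE (node_point_node e0r _ ts). Qed.

Lemma node_val_ev (f : edge T -> R -> R) c lam kap f1 : tree_sol l q lam kap c f f1 ->
  (forall v, f (ev v).1 (ev v).2 = 0) -> forall v : Nd, node_val l c f v = 0.
Proof.
by move=> ts z v; rewrite (node_point_node e0r _ ts) -[RHS](z (enum_rank v)) /ev enum_rankK.
Qed.

Lemma node_val_root c f f1 lam kap : tree_sol l q lam kap c f f1 ->
  (forall j x, 0 <= x <= l -> f j x = 0) -> c (root T) = 0.
Proof.
move=> [_ fc _] z; have [H _] := fc e0.
by rewrite -e0r -H z// lexx ltW.
Qed.

Lemma nval_enum (C : 'rV[R]_#|Nd|) v : nval C (enum_val v) = C 0 v.
Proof. by rewrite /nval enum_valK. Qed.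

Lemma multiplicity_N lam : - lam0 h K < lam -> lam < 0 ->
  multiplicity (dom_N l) (L_N l q) lam =
  (nullity (robin M rn (fun=> 0) lam))%:R%:E.
Proof.
move=> lam1 lam2; have lamP : - lam0 h K <= lam <= 0 by rewrite !ltW.
apply: (@multiplicityE _ _ _ _ _ _ (eig_real_N lam) ev).
- exact: eig_real_N_lin.
- exact: eig_real_N0.
- by move=> y /eigenspace_N_S[].
- by move=> y /eigenspace_N_S[].
- by move=> f [c [f1 fs]]; exact: eigenspace_N fs.
- by move=> f [c [f1 fs]]; rewrite (row_node_val fs); exact: (tree_sol_ker (kf := fun=> 0) l0 qi ME lamP fs).
- move=> C CB; have [y [y1 [ys yC]]] := ker_tree_sol l0 qi hK qK ME lamP CB.
  exists y; first by exists (fun v => nval C (inl v : Nd)), y1.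
  move=> v; rewrite /ev -(node_point_node e0r _ ys) yC; exact: nval_enum.
- move=> f [c [f1 fs]] ae v; apply: (tree_sol_ae0 fs ae); exact: node_point_in.
- move=> f [c [f1 fs]] z j x; rewrite /dom_N /= in_itv/=.
  exact: (tree_sol_zero (kf := fun=> 0) l0 qi hK qK lamP fs (node_val_ev fs z)).
Qed.

Lemma multiplicity_oo lam : - lam0 h K < lam -> lam < 0 ->
  multiplicity (dom_oo l) (L_oo l q) lam =
  (nullity (robin M rn (fun t => Num.sqrt (- t)) lam))%:R%:E.
Proof.
move=> lam1 lam2; have lamP : - lam0 h K <= lam <= 0 by rewrite !ltW.
pose kf t : R := Num.sqrt (- t).
apply: (@multiplicityE _ _ _ _ _ _ (eig_real_oo lam) (fun v => (Some (ev v).1, (ev v).2))).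
- exact: eig_real_oo_lin.
- exact: eig_real_oo0.
- by move=> y /(eigenspace_oo_S lam2)[].
- by move=> y /(eigenspace_oo_S lam2)[].
- by move=> f [c [f1 [fs fN]]]; exact: eigenspace_oo fs fN.
- move=> f [c [f1 [fs fN]]] /=.
  by rewrite (row_node_val fs); exact: (tree_sol_ker (kf := kf) l0 qi ME lamP fs).
- move=> C CB; have [y [y1 [ys yC]]] := ker_tree_sol l0 qi hK qK ME lamP CB.
  exists (fun j x => if j is Some j then y j x else
    nval C (inl (root T) : Nd) * expR (- Num.sqrt (- lam) * x)).
    by exists (fun v => nval C (inl v : Nd)), y1.
  move=> v; rewrite /= /ev -(node_point_node e0r _ ys) yC; exact: nval_enum.
- move=> f [c [f1 [fs fN]]] ae v; apply: (tree_sol_ae0 fs (fun j => ae (Some j))).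
  exact: node_point_in.
- move=> f [c [f1 [fs fN]]] z.
  have fz := tree_sol_zero (kf := kf) l0 qi hK qK lamP fs (node_val_ev fs z).
  case=> [j|] x; rewrite /= in_itv/= ?andbT; first exact: fz.
  by move=> x0; rewrite fN// (node_val_root fs fz) mul0r.
Qed.

Let ev0 (I : Type) (p : I) (i : 'I_0) : I := p.

Let nullity0 : nullity (0 : 'M[R]_0) = 0%N.
Proof. by apply/eqP; rewrite /nullity -leqn0 rank_leq_row. Qed.

(** The space of real eigenfunctions is zero, that is, it is the kernel of the
    empty matrix. *)
Lemma multiplicity_N_low lam : lam <= - lam0 h K ->
  multiplicity (dom_N l) (L_N l q) lam = 0.
Proof.
move=> lamP.
rewrite (@multiplicityE _ _ _ _ _ _ (eig_real_N lam) (ev0 (e0, 0)) 0) ?nullity0//.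
- exact: eig_real_N_lin.
- exact: eig_real_N0.
- by move=> y /eigenspace_N_S[].
- by move=> y /eigenspace_N_S[].
- by move=> f [c [f1 fs]]; exact: eigenspace_N fs.
- by move=> f _; rewrite mulmx0.
- by move=> C _; exists (fun _ _ => 0); [exact: eig_real_N0|case].
- by move=> f _ _ [].
- move=> f [c [f1 fs]] _ j x; rewrite /dom_N /= in_itv/=.
  exact: (tree_sol_low l0 qi K0 hK qK fs (lexx 0) lamP).
Qed.

Lemma multiplicity_oo_low lam : lam <= - lam0 h K ->
  multiplicity (dom_oo l) (L_oo l q) lam = 0.
Proof.
move=> lamP.
have lam2 : lam < 0.
  apply: le_lt_trans lamP _; rewrite oppr_lt0; apply: lam0_gt0 => //.
  by rewrite divr_gt0.
rewrite (@multiplicityE _ _ _ _ _ _ (eig_real_oo lam) (ev0 (None, 0)) 0) ?nullity0//.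
- exact: eig_real_oo_lin.
- exact: eig_real_oo0.
- by move=> y /(eigenspace_oo_S lam2)[].
- by move=> y /(eigenspace_oo_S lam2)[].
- by move=> f [c [f1 [fs fN]]]; exact: eigenspace_oo fs fN.
- by move=> f _; rewrite mulmx0.
- by move=> C _; exists (fun _ _ => 0); [exact: eig_real_oo0|case].
- by move=> f _ _ [].
- move=> f [c [f1 [fs fN]]] _.
  have fz := tree_sol_low l0 qi K0 hK qK fs (sqrtr_ge0 _) lamP.
  case=> [j|] x; rewrite /= in_itv/= ?andbT; first exact: fz.
  by move=> x0; rewrite fN// (node_val_root fs fz) mul0r.
Qed.

Lemma esum_nullity (m : R -> \bar R) (kap : R -> R) :
  (forall lam, lam <= - lam0 h K -> m lam = 0) ->
  (forall lam, - lam0 h K < lam -> lam < 0 ->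
     m lam = (nullity (robin M rn kap lam))%:R%:E) ->
  (forall t, t <= 0 -> 0 <= kap t) ->
  (forall s t, s <= t -> t <= 0 -> kap t <= kap s) ->
  (forall t, t <= 0 -> forall e, 0 < e -> exists2 d, 0 < d &
     forall s, s <= 0 -> `|s - t| < d -> `|kap s - kap t| <= e) ->
  kap 0 = 0 ->
  \esum_(lam in [set lam | lam < 0]) m lam = (neg_index (M 0))%:R%:E.
Proof.
move=> mlow mE k_ge0 k_decr k_cont k0.
have -> : neg_index (M 0) = neg_index (robin M rn kap 0) by rewrite /robin k0 scale0r addr0.
have h0 : 0 < h by rewrite divr_gt0.
rewrite -(robin_count h0 K0 hK (@beE R T l N') (fun p => piece_pot_intg l0 qi p)
  (fun p => piece_pot_K l0 qi qK p) ME
  (@piece_end_touch T N') rn k_ge0 k_decr k_cont).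
have -> : [set t : R | - lam0 h K < t < 0] =
    [set t | t < 0] `&` [set t | - lam0 h K < t].
  by apply/seteqP; split=> t /=; [move=> /andP[]|move=> [-> ->]].
rewrite esum_mkcondr; apply: eq_esum => t t0.
case: ifPn; rewrite ?inE ?notin_setE/= => tl; first exact: mE.
by apply: mlow; rewrite leNgt; apply/negP.
Qed.

End eigenfunctions.

Lemma sqrt_lip (R : realType) (a b : R) : 0 <= a -> 0 <= b ->
  (Num.sqrt a - Num.sqrt b) ^+ 2 <= `|a - b|.
Proof.
move=> a0 b0; have := sqr_sqrtr a0; have := sqr_sqrtr b0.
have := sqrtr_ge0 a; have := sqrtr_ge0 b.
set x := Num.sqrt a; set y := Num.sqrt b => y0 x0 <- <-.
have -> : x ^+ 2 - y ^+ 2 = (x - y) * (x + y) by ring.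
rewrite normrM [X in _ * X]ger0_norm ?addr_ge0// -[leLHS]real_normK ?num_real//.
by rewrite expr2 ler_wpM2l// (le_trans (ler_normB _ _))// !ger0_norm.
Qed.

Theorem lemma4p8 (R : realType) (T : rooted_tree) (l : R)
    (q : edge T -> R -> R)
    (hl : 0 < l)
    (hq : forall j : edge T, L2 `[0, l] (q j)) :
  num_neg_eigenvalues (dom_oo (T := T) l) (L_oo l q) =
  num_neg_eigenvalues (dom_N (T := T) l) (L_N l q).
Proof.
have [e0 e0r] := root_out T.
have qi j : intg 0 l (q j) := L2_intg (hq j).
(* The summand 1 makes [K] positive when all potentials vanish. *)
pose K : R := 1 + \sum_j itg 0 l (fun t => `|q j t|).
have I0 j : 0 <= itg 0 l (fun t => `|q j t|) by exact: itg_ge0.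
have K0 : 0 < K by rewrite ltr_pwDl// sumr_ge0.
have qK j : itg 0 l (fun t => `|q j t|) <= K.
  by rewrite /K (bigD1 j)//= addrCA lerDl addr_ge0// sumr_ge0.
have [N' hK] : exists N', l / N'.+1%:R * K <= 20^-1.
  have lK : 0 <= l * K * 20 by rewrite !mulr_ge0// ltW.
  exists (Num.bound (l * K * 20)).
  have := archi_boundP lK; set N := Num.bound _ => lN.
  have N0 : 0 < N.+1%:R :> R by rewrite ltr0n.
  rewrite mulrAC ler_pdivrMr// (_ : N.+1%:R = N%:R + 1); last by rewrite natr1.
  by lra.
have h0 : 0 < l / N'.+1%:R by rewrite divr_gt0.
have [M ME] := dtn_exists (@piece_end T N') h0 hK (@beE R T l N')
  (fun p => piece_pot_intg hl qi p) (fun p => piece_pot_K hl qi qK p).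
transitivity ((neg_index (M 0))%:R%:E : \bar R).
  apply: (esum_nullity hl hq K0 hK qK ME (kap := fun t => Num.sqrt (- t))).
  - by move=> lam lamP; exact: (multiplicity_oo_low hl hq e0r K0 hK qK lamP).
  - by move=> lam l1 l2; exact: (multiplicity_oo hl hq e0r hK qK ME l1 l2).
  - by move=> t _; exact: sqrtr_ge0.
  - by move=> s t st t0; rewrite ler_wsqrtr// lerN2.
  - move=> t t0 e e0'; exists (e ^+ 2); first by rewrite exprn_gt0.
    move=> s s0 st; have := @sqrt_lip R (- s) (- t); rewrite !oppr_ge0 => /(_ s0 t0).
    rewrite -opprD normrN => H; rewrite leNgt; apply/negP => eH.
    have : e ^+ 2 < `|Num.sqrt (- s) - Num.sqrt (- t)| ^+ 2.
      by rewrite ltrXn2r// ?nnegrE// ltW.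
    by rewrite real_normK ?num_real//; lra.
  - by rewrite oppr0 sqrtr0.
apply/esym; apply: (esum_nullity hl hq K0 hK qK ME (kap := fun=> 0)).
- by move=> lam lamP; exact: (multiplicity_N_low hl hq e0r K0 hK qK lamP).
- by move=> lam l1 l2; exact: (multiplicity_N hl hq e0r hK qK ME l1 l2).
- by [].
- by [].
- by move=> t _ e e0'; exists 1 => // s _ _; rewrite subrr normr0 ltW.
- by [].
Qed.
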